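(* Let $\mu>0$. For $\beta>u>0$ $$\mathbf{Q}^\mu_0(D^-_{H_\beta}<u)=\frac{S^{-\mu}(\beta)}{S^{-\mu}(u)}\exp\left(-\frac{\beta-u}{S^{-\mu}(u)}-2\mu(\beta-u)\right).$$ For the 3-dimensional Bessel process without drift, i.e. $\mu=0$, one has for $\beta>u>0$ $$\mathbf{Q}_0(D^-_{H_\beta}<u)=\frac{\beta}{u}\exp\left(-\frac{\beta-u}{u}\right).$$
   Context: On the canonical space of continuous functions with coordinate process $X$, $H_\beta:=\inf\{t:X_t=\beta\}$ and $D^-_{H_\beta}:=\sup\{X_s-X_t:0\le s\le t\le H_\beta\}$ is the maximum decrease up to $H_\beta$. For $\mu>0$, $\mathbf{Q}^\mu_0$ is the law under which $X$ is the 3-dimensional Bessel process with drift $\mu$ started from $0$, i.e. the diffusion on $(0,\infty)$ with generator $\frac12\frac{d^2}{dx^2}+\mu\coth(\mu x)\frac{d}{dx}$ started from the entrance boundary $0$; for $\mu=0$, $\mathbf{Q}_0$ is the law of the usual 3-dimensional Bessel process (generator $\frac12\frac{d^2}{dx^2}+\frac1x\frac{d}{dx}$) started from $0$. For real $\nu\ne0$, $S^\nu(x):=\frac{1}{2\nu}(1-e^{-2\nu x})$, so $S^{-\mu}(x)=\frac{1}{2\mu}(e^{2\mu x}-1)$; and $S^0(x):=x$. *)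

(* Defs.v *)
From HB Require Import structures.
From mathcomp Require Import all_boot all_order all_algebra.
From mathcomp Require Import all_classical all_reals all_analysis.

Set Implicit Arguments.
Unset Strict Implicit.
Unset Printing Implicit Defensive.

Import Order.TTheory GRing.Theory Num.Theory.
Import numFieldNormedType.Exports.

Local Open Scope classical_set_scope.
Local Open Scope ring_scope.

(* C([0, +oo[, R): a continuous function on the half-line is encoded by its
   unique extension to R that is constant on the negative half-line. *)
Record cpath (R : realType) := CPath {
  cpath_fun : R -> R ;
  cpath_continuous : continuous cpath_fun ;
  cpath_neg : forall t : R, t <= 0 -> cpath_fun t = cpath_fun 0
}.

Definition cpath0 (R : realType) : cpath R :=
  @CPath R (fun=> 0) (fun=> cvg_cst _) (fun t _ => erefl).

HB.instance Definition _ (R : realType) := gen_eqMixin (cpath R).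
HB.instance Definition _ (R : realType) := gen_choiceMixin (cpath R).
HB.instance Definition _ (R : realType) := isPointed.Build (cpath R) (cpath0 R).

(* The events {X_r \in B} with r \in I and B Borel. *)
Definition coordinate_events (R : realType) (I : set R) : set (set (cpath R)) :=
  [set A | exists r : R, exists B : set R, [/\ I r, measurable B &
    A = [set w | B (cpath_fun w r)]]].

Definition path_space (R : realType) :=
  g_sigma_algebraType (@coordinate_events R [set r | 0 <= r]).

Definition coordinate (R : realType) (t : R) (w : path_space R) : R :=
  cpath_fun w t.

Definition natural_filtration (R : realType) (t : R) : set (set (path_space R)) :=
  <<s @coordinate_events R [set r | 0 <= r <= t] >>.

(* Martingales indexed by [0, +oo[; E[M_t | F_s] = M_s is expressed by the
   defining property of the conditional expectation. *)
Definition martingale (R : realType) (d : measure_display)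
    (T : measurableType d) (P : probability T R) (F : R -> set (set T))
    (M : R -> T -> R) : Prop :=
  [/\ forall t, 0 <= t -> forall B : set R, measurable B -> F t (M t @^-1` B),
      forall t, 0 <= t -> P.-integrable [set: T] (fun w => (M t w)%:E) &
      forall s t, 0 <= s -> s <= t -> forall A, F s A ->
        (\int[P]_(w in A) (M t w)%:E = \int[P]_(w in A) (M s w)%:E)%E].

(* f is twice continuously differentiable with compact support in ]0, +oo[. *)
Definition C2c_pos (R : realType) (f : R -> R) : Prop :=
  [/\ forall x, derivable f x 1,
      forall x, derivable (derive1 f) x 1,
      continuous (derive1 (derive1 f)) &
      exists a b : R, 0 < a /\ forall x, f x != 0 -> a <= x <= b].

Definition coth (R : realType) (x : R) : R :=
  (expR x + expR (- x)) / (expR x - expR (- x)).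

Definition bessel3_drift (R : realType) (mu x : R) : R :=
  if mu == 0 then x^-1 else mu * coth (mu * x).

Definition bessel3_generator (R : realType) (mu : R) (f : R -> R) (x : R) : R :=
  2^-1 * derive1 (derive1 f) x + bessel3_drift mu x * derive1 f x.

(* Q is the law of the diffusion on ]0, +oo[ with generator
   bessel3_generator mu started from the entrance boundary 0, i.e. the solution
   of the martingale problem for this generator which starts at 0 and stays in
   ]0, +oo[ at all positive times. The last condition excludes the spurious
   solutions that remain at 0 for a while or are absorbed there, which test
   functions supported away from 0 do not detect. *)
Definition bessel3_law (R : realType) (mu : R)
    (Q : probability (path_space R) R) : Prop :=
  {ae Q, forall w, coordinate 0 w = 0 /\ forall t, 0 < t -> 0 < coordinate t w}
  /\ forall f : R -> R, C2c_pos f ->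
     martingale Q (@natural_filtration R) (fun t w =>
       f (coordinate t w) - f (coordinate 0 w) -
       \int[lebesgue_measure]_(r in `[0, t])
         bessel3_generator mu f (coordinate r w)).

Definition hitting_time (R : realType) (b : R) (w : path_space R) : \bar R :=
  ereal_inf [set t%:E | t in [set t : R | 0 <= t /\ coordinate t w = b]].

(* D^-_tau; the times s, t are finite even if tau = +oo. *)
Definition max_decrease (R : realType) (tau : \bar R) (w : path_space R)
    : \bar R :=
  ereal_sup [set x : \bar R | exists s t : R,
    [/\ 0 <= s, s <= t, (t%:E <= tau)%E &
        x = (coordinate s w - coordinate t w)%:E]].

Definition scale (R : realType) (nu x : R) : R :=
  if nu == 0 then x else (2 * nu)^-1 * (1 - expR (- (2 * nu * x))).

(* Main.v *)
Require Import Defs.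
From HB Require Import structures.
From mathcomp Require Import all_boot all_order all_algebra.
From mathcomp Require Import all_classical all_reals all_analysis.
From mathcomp Require Import measurable_realfun ring lra.

(**
Write [s] for the scale function and [S] for the running maximum of the path
[X].  The function [F(x, m) = a(m) s(x) + b(m)], where [a] and [b] are chosen
so that [F(m - u, m) = 0] and [b' = - s a'], is harmonic in [x] and satisfies
[d/dm F(x, m) = 0] on the diagonal [x = m]; hence [F(X, S)] is a martingale
until [S] reaches [beta] or [X] has dropped by [u] below [S].  It then equals
[F(beta, beta)] or [0], which gives the probability as [b(u) / F(beta, beta)].

No stochastic calculus is needed.  Along a grid of step [1 / (n + 1)], the sum
of [a(S)] times the increments of the martingale attached to a compactly
supported modification of [s] has zero expectation, is bounded uniformly in
[n] by Abel summation, and converges pathwise to the increment of [F(X, S)],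
because [S] only increases when [X] is close to [S].  The singularity of [s] at
the entrance boundary [0] is avoided by starting at a level [v > u] (before
[S] exceeds [v] the integrand [a(S \/ v) - a(v)] vanishes) and then letting
[v] decrease to [u].  Finiteness of the hitting time of [beta] comes from the
generator being at least [1] on [x ^ 2].
*)

Set Implicit Arguments.
Unset Strict Implicit.
Unset Printing Implicit Defensive.

Import Order.TTheory GRing.Theory Num.Theory.
Import numFieldNormedType.Exports.

Local Open Scope classical_set_scope.
Local Open Scope ring_scope.

(** * The scale function *)

(** The pair [a], [b] is explicit. With [s = - hcos / hsin], the condition [F(m - u, m) = 0] makes
    [a(m)] and [b(m)] proportional to [hsin (m - u)] and [hcos (m - u)] with a common factor [c(m)],
    and [b' = - s a'] then reduces to [c' = kappa c] with [kappa = hcos u / hsin u]. This is the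
    origin of the exponential in the result.

    Starting at [v] has a price: the stopped value acquires the extra term [- a(v) s(X)]. Since
    [a(u) = 0], its factor [a(v)] vanishes in the limit, but [s] is unbounded near [0]. On each path
    this is repaired by noting that the stopping times stay above a positive time that does not
    depend on [v].

    Abel summation gives a bound free of the grid because [a] is increasing, so the weights [a(S)]
    are nondecreasing along the path until it is stopped. *)

Section hyperbolic.
Context {R : realType}.
Variable mu : R.

(* [sinh (mu * x) / mu], extended by its limit [x] at [mu = 0]: the processes with
   and without drift then have the same formulas. *)
Definition hsin (x : R) : R :=
  if mu == 0 then x else (expR (mu * x) - expR (- (mu * x))) / (2 * mu).

Definition hcos (x : R) : R := (expR (mu * x) + expR (- (mu * x))) / 2.

Lemma is_derive_hsin (x : R) : is_derive x 1 hsin (hcos x).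
Proof.
rewrite /hsin /hcos; case: eqVneq => [->|mu0].
  by apply: is_derive_eq; rewrite !mul0r oppr0 expR0 divff // pnatr_eq0.
by apply: is_derive_eq; rewrite /GRing.scale /=; field.
Qed.

Lemma is_derive_hcos (x : R) : is_derive x 1 hcos (mu ^+ 2 * hsin x).
Proof.
rewrite /hsin /hcos; apply: is_derive_eq; rewrite /GRing.scale /=.
case: eqVneq => [->|mu0]; first by rewrite !(mul0r, mulr0, oppr0, addr0, scaler0) expr0n/= mul0r.
by field.
Qed.

Lemma hsin0 : hsin 0 = 0.
Proof. by rewrite /hsin mulr0 oppr0 subrr mul0r if_same. Qed.

Lemma hsinB x y : hsin (x - y) = hsin x * hcos y - hcos x * hsin y.
Proof.
rewrite /hsin /hcos; case: eqVneq => [->|mu0].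
  by rewrite !mul0r oppr0 expR0; field.
rewrite mulrBr opprB !expRD !expRN; field.
by rewrite mu0 !gt_eqF ?expR_gt0.
Qed.

Lemma hcosB x y : hcos (x - y) = hcos x * hcos y - mu ^+ 2 * hsin x * hsin y.
Proof.
rewrite /hsin /hcos; case: eqVneq => [->|mu0].
  by rewrite !mul0r oppr0 expR0; field.
rewrite mulrBr opprB !expRD !expRN; field.
by rewrite mu0 !gt_eqF ?expR_gt0.
Qed.

Lemma hcos2_hsin2 x : hcos x ^+ 2 - mu ^+ 2 * hsin x ^+ 2 = 1.
Proof.
rewrite /hsin /hcos; case: eqVneq => [->|mu0].
  by rewrite !mul0r oppr0 expR0; field.
by rewrite !expRN; field; rewrite mu0 !gt_eqF ?expR_gt0.
Qed.

Lemma hcos_gt0 x : 0 < hcos x.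
Proof. by rewrite divr_gt0// addr_gt0 ?expR_gt0. Qed.

Lemma hsin_gt0 x : 0 < x -> 0 < hsin x.
Proof.
move=> x0; rewrite /hsin; case: eqVneq => // mu0.
have [mup|mun] := ltP 0 mu.
  by rewrite divr_gt0 ?mulr_gt0// subr_gt0 ltr_expR; nra.
have {}mun : mu < 0 by rewrite lt_neqAle mu0.
by rewrite nmulr_lgt0 ?invr_lt0 ?subr_lt0 ?ltr_expR; nra.
Qed.

Lemma bessel3_driftE x : x != 0 -> bessel3_drift mu x = hcos x / hsin x.
Proof.
move=> x0; rewrite /bessel3_drift /hcos /hsin /coth.
case: eqVneq => [->|mu0].
  by rewrite mul0r oppr0 expR0; field.
field; rewrite mu0 /=; rewrite subr_eq0.
apply/negP => /eqP /expR_inj /eqP; rewrite -subr_eq0 opprK -mulr2n mulrn_eq0/=.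
by rewrite mulf_eq0 (negbTE mu0) (negbTE x0).
Qed.

(** This is [- mu coth (mu x)], or [- 1 / x] when [mu = 0]. It is a scale function of the diffusion:
    its derivative [y = hsin ^- 2] solves [y' + 2 (hcos / hsin) y = 0]. It tends to minus infinity
    at [0]. *)
Definition hscale x := - (hcos x / hsin x).

Lemma is_derive_hscale (x : R) : 0 < x ->
  is_derive x 1 hscale (hsin x ^- 2).
Proof.
move=> x0; have s0 := lt0r_neq0 (hsin_gt0 x0).
have := is_deriveV s0 (is_derive_hsin x) => dV.
have dc := is_derive_hcos x.
rewrite /hscale; apply: is_derive_eq; rewrite /GRing.scale /=.
rewrite -[RHS]mul1r -(hcos2_hsin2 x).
by field.
Qed.

Lemma is_derive_hscale' (x : R) : 0 < x ->
  is_derive x 1 (fun y => hsin y ^- 2) (- 2 * hcos x / hsin x ^+ 3).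
Proof.
move=> x0; have s0 := lt0r_neq0 (hsin_gt0 x0).
have ds := is_derive_hsin x.
have d2 : is_derive x 1 (fun y => hsin y ^+ 2) (2 * hsin x * hcos x).
  by apply: is_derive_eq; rewrite /GRing.scale /=; ring.
have /is_deriveV := d2; move=> H; have := H (expf_neq0 2 s0) => {}H.
apply: is_derive_eq; rewrite /GRing.scale /=.
by field.
Qed.

Variable u : R.
Hypothesis u0 : 0 < u.

(* [wgt m * hscale x + off m] is, up to a constant factor, the probability that
   [beta] is reached before a drop of size [u], when the process is at [x] and its
   running maximum is [m]. *)
Definition kappa := hcos u / hsin u.
Definition wgt m := expR (kappa * m) * hsin (m - u) / hsin u.
Definition off m := expR (kappa * m) * hcos (m - u) / hsin u.

Lemma is_derive_wgt (m : R) :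
  is_derive m 1 wgt (expR (kappa * m) * hsin m / hsin u ^+ 2).
Proof.
have s0 := lt0r_neq0 (hsin_gt0 u0).
have ds : is_derive m 1 (fun m => hsin (m - u)) (hcos (m - u)).
  have d1 := is_derive_hsin (m - u).
  have d2 : is_derive m 1 (fun m => m - u) 1 by apply: is_derive_eq; rewrite subr0.
  by have := @is_derive1_comp _ hsin (fun m => m - u) m _ _ d1 d2; rewrite mulr1.
rewrite /wgt; apply: is_derive_eq; rewrite /GRing.scale /=.
rewrite /kappa hsinB hcosB.
rewrite -[RHS]mulr1 -[in RHS](hcos2_hsin2 u).
by field.
Qed.

(** Together with [is_derive_wgt] this is the relation [off' = - hscale * wgt']. The choice of
    [kappa] makes the addition formulas collapse: [kappa * hcos (m - u) + mu ^+ 2 * hsin (m - u) =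
    hcos m / hsin u], and similarly for [wgt]. *)
Lemma is_derive_off (m : R) :
  is_derive m 1 off (expR (kappa * m) * hcos m / hsin u ^+ 2).
Proof.
have s0 := lt0r_neq0 (hsin_gt0 u0).
have ds : is_derive m 1 (fun m => hcos (m - u)) (mu ^+ 2 * hsin (m - u)).
  have d1 := is_derive_hcos (m - u).
  have d2 : is_derive m 1 (fun m => m - u) 1 by apply: is_derive_eq; rewrite subr0.
  by have := @is_derive1_comp _ hcos (fun m => m - u) m _ _ d1 d2; rewrite mulr1.
rewrite /off; apply: is_derive_eq; rewrite /GRing.scale /=.
rewrite /kappa hsinB hcosB.
rewrite -[RHS]mulr1 -[in RHS](hcos2_hsin2 u).
by field.
Qed.

(** The product form shows the boundary values: zero at [x = m - u], positive for larger positive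
    [x], and [expR (kappa * m) / hsin m] on the diagonal [x = m]. *)
Lemma wgt_scale_off x m : hsin x != 0 ->
  wgt m * hscale x + off m = expR (kappa * m) * hsin (x - (m - u)) / (hsin u * hsin x).
Proof.
move=> s0; have su := lt0r_neq0 (hsin_gt0 u0).
by rewrite /wgt /off /hscale (hsinB x (m - u)); field; rewrite s0 su.
Qed.
End hyperbolic.

(** * Compactly supported test functions *)

Section cutoff.
Context {R : realType}.
Implicit Types (x y : R) (f g chi phi : R -> R).

Lemma continuous_pospart : continuous (fun y : R => Num.max y 0).
Proof.
by move=> y; apply: continuous_max; [exact: cvg_id|exact: cvg_cst].
Qed.

(** With exponent at least two the corner of the positive part disappears: at [0] the difference
    quotient is [Num.max h 0 ^+ n.+1], which tends to [0]. Cubes are therefore twice continuously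
    differentiable. *)
Lemma is_derive_pospartX n y :
  is_derive y 1 (fun y => Num.max y 0 ^+ n.+2) (n.+2%:R * Num.max y 0 ^+ n.+1).
Proof.
have [y0|y0|->] := ltgtP y 0.
- apply: (@near_eq_is_derive _ _ _ (cst 0)).
    near=> z; rewrite /= max_r ?expr0n//.
    by apply: ltW; near: z; exact: lt_nbhsl.
  by rewrite expr0n mulr0; exact: is_derive_cst.
- apply: (@near_eq_is_derive _ _ _ (fun z : R => z ^+ n.+2)).
    near=> z; rewrite /= max_l//.
    by apply: ltW; near: z; exact: lt_nbhsr.
  apply: DeriveDef; first exact: exprn_derivable.
  by rewrite exp_derive /GRing.scale/= mulr1.
rewrite expr0n/= mulr0.
suff H : h^-1 *: ((fun y => Num.max y 0 ^+ n.+2) (h *: 1 + 0) -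
    Num.max 0 0 ^+ n.+2) @[h --> (0 : R)^'] --> (0 : R).
  by apply: DeriveDef; [apply/cvg_ex; exists 0|exact/cvg_lim].
apply: (@cvg_trans _ ((fun h => Num.max h 0 ^+ n.+1) @ (0 : R)^')).
  apply: near_eq_cvg; near=> h.
  have h0 : h != 0 by near: h; exact: nbhs_dnbhs_neq.
  rewrite maxxx expr0n/= subr0 addr0 /GRing.scale/= mulr1.
  case: (leP h 0) => hh; first by rewrite !expr0n/= mulr0.
  by rewrite [in RHS]exprS mulKf.
apply: cvg_within_filter.
have H : Num.max h 0 ^+ n.+1 @[h --> (0 : R)] --> Num.max (0 : R) 0 ^+ n.+1.
  apply: (@continuous_comp _ _ _ (fun h : R => Num.max h 0) (fun y : R => y ^+ n.+1)).
    exact: continuous_pospart.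
  exact: exprn_continuous.
have e : Num.max (0 : R) 0 ^+ n.+1 = 0 by rewrite maxxx expr0n.
by rewrite e in H.
Unshelve. all: by end_near. Qed.

(** [phi] may be singular at [0]: to the left of [a > 0] the product is locally zero, so the product
    rule holds on the whole line. *)
Lemma is_derive_mul_vanish chi phi chi' phi' a :
  0 < a ->
  (forall x, is_derive x 1 chi (chi' x)) ->
  (forall x, 0 < x -> is_derive x 1 phi (phi' x)) ->
  (forall x, x <= a -> chi x = 0 /\ chi' x = 0) ->
  forall x, is_derive x 1 (fun y => chi y * phi y) (chi' x * phi x + chi x * phi' x).
Proof.
move=> a0 dchi dphi van x; have [x0|x0] := ltP 0 x.
  have := dphi x x0 => {}dphi; have {}dchi := dchi x.
  by apply: is_derive_eq; rewrite /GRing.scale /=; ring.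
have xa : x < a by exact: le_lt_trans a0.
have [-> ->] := van x (ltW xa); rewrite !mul0r addr0.
apply: (@near_eq_is_derive _ _ _ (cst (0 : R) : R -> R)).
near=> z; have [|-> _] := van z; last by rewrite mul0r.
by apply: ltW; near: z; exact: lt_nbhsl.
Unshelve. all: by end_near. Qed.

Lemma continuous_mul_vanish chi phi a : 0 < a ->
  continuous chi -> (forall x, 0 < x -> {for x, continuous phi}) ->
  (forall x, x <= a -> chi x = 0) ->
  continuous (fun y => chi y * phi y).
Proof.
move=> a0 cchi cphi van x; have [x0|x0] := ltP 0 x.
  by apply: cvgM; [exact: cchi|exact: cphi].
have xa : x < a by exact: le_lt_trans a0.
rewrite /continuous_at (van x (ltW xa)) mul0r.
have H : (cst (0 : R)) y @[y --> x] --> (0 : R) by exact: cvg_cst.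
apply: cvg_trans H.
apply: near_eq_cvg; near=> z; rewrite /= van ?mul0r//.
by apply: ltW; near: z; exact: lt_nbhsl.
Unshelve. all: by end_near. Qed.

(** The cutoff is [1 - r ^+ 3], where [r] is the positive part of [1 - q ^+ 3] and [q] that of a
    concave parabola [l] with roots [a0 / 2] and [b0 + 1]. The scaling of [l] gives [l >= 1] on
    [[a0, b0]], hence [r = 0] and the value [1] there; where [l <= 0], [r = 1] and the value is
    [0]. *)
Lemma cutoff_exists (a0 b0 : R) : 0 < a0 -> a0 <= b0 ->
  exists chi chi' chi'' : R -> R,
  [/\ forall x, is_derive x 1 chi (chi' x),
      forall x, is_derive x 1 chi' (chi'' x),
      continuous chi'',
      forall x, 0 <= chi x <= 1 &
      (forall x, a0 <= x <= b0 -> chi x = 1) /\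
      (forall x, ~~ (a0 / 2 < x < b0 + 1) ->
         [/\ chi x = 0, chi' x = 0 & chi'' x = 0])].
Proof.
move=> a00 ab.
pose p (y : R) := Num.max y 0.
pose l x := (x - a0 / 2) * (b0 + 1 - x) / (a0 / 2).
pose l' x := (b0 + 1 + a0 / 2 - 2 * x) / (a0 / 2).
pose q x := p (l x).
pose r x := p (1 - q x ^+ 3).
pose q1 x := 3 * q x ^+ 2 * l' x.
pose l2 := - 2 / (a0 / 2).
pose q2 x := 3 * (2 * q x * l' x ^+ 2 + q x ^+ 2 * l2).
have dl (x : R) : is_derive x 1 l (l' x).
  rewrite /l /l'; apply: is_derive_eq; rewrite /GRing.scale /=; field.
  by rewrite gt_eqF.
have dl' (x : R) : is_derive x 1 l' l2.
  rewrite /l2 /l'; apply: is_derive_eq; rewrite /GRing.scale /=; field.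
  by rewrite gt_eqF.
have dpX n (g : R -> R) (x dg : R) : is_derive x 1 g dg ->
    is_derive x 1 (fun x => p (g x) ^+ n.+2) (n.+2%:R * p (g x) ^+ n.+1 * dg).
  move=> hg.
  exact: (@is_derive1_comp _ (fun y => p y ^+ n.+2) g x _ _ (is_derive_pospartX n (g x)) hg).
have dq3 (x : R) : is_derive x 1 (fun x => q x ^+ 3) (q1 x) by exact: dpX.
have dq2 (x : R) : is_derive x 1 (fun x => q x ^+ 2) (2 * q x * l' x) by exact: dpX.
have dq1 (x : R) : is_derive x 1 q1 (q2 x).
  have h1 := dl' x; have h2 := dq2 x.
  by rewrite /q1 /q2; apply: is_derive_eq; rewrite /GRing.scale/=; ring.
have dw (x : R) : is_derive x 1 (fun x => 1 - q x ^+ 3) (- q1 x).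
  by have h := dq3 x; apply: is_derive_eq; ring.
have dr3 (x : R) : is_derive x 1 (fun x => r x ^+ 3) (3 * r x ^+ 2 * - q1 x) by exact: dpX.
have dr2 (x : R) : is_derive x 1 (fun x => r x ^+ 2) (2 * r x * - q1 x) by exact: dpX.
have is_derive_cont (f df : R -> R) : (forall x : R, is_derive x 1 f (df x)) -> continuous f.
  by move=> h x; apply: differentiable_continuous; apply/derivable1_diffP; have [] := h x.
have cl := is_derive_cont _ _ dl.
have cl' := is_derive_cont _ _ dl'.
have cq1 := is_derive_cont _ _ dq1.
have cq2 := is_derive_cont _ _ dq2.
have cr2 := is_derive_cont _ _ dr2.
have cq : continuous q.
  by move=> x; apply: (continuous_comp (cl x)); exact: continuous_pospart.
have cr : continuous r.
  move=> x; apply: (continuous_comp (is_derive_cont _ _ dw x)); exact: continuous_pospart.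
have q0 x : 0 <= q x by rewrite le_max lexx orbT.
have r0 x : 0 <= r x by rewrite le_max lexx orbT.
exists (fun x => 1 - r x ^+ 3), (fun x => 3 * (r x ^+ 2 * q1 x)),
  (fun x => 3 * (2 * r x * - q1 x * q1 x + r x ^+ 2 * q2 x)); split.
- by move=> x; have h := dr3 x; apply: is_derive_eq; ring.
- move=> x; have h1 := dr2 x; have h2 := dq1 x.
  by apply: is_derive_eq; rewrite /GRing.scale/=; ring.
- move=> x; apply: cvgM; first exact: cvg_cst.
  apply: cvgD.
    apply: cvgM; last exact: cq1.
    apply: cvgM; last by apply: cvgN; exact: cq1.
    by apply: cvgM; [exact: cvg_cst|exact: cr].
  apply: cvgM; first exact: cr2.
  apply: cvgM; first exact: cvg_cst.
  apply: cvgD; last by apply: cvgM; [exact: cq2|exact: cvg_cst].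
  apply: cvgM; last by apply: (@continuous_comp _ _ _ l' (fun y : R => y ^+ 2));
    [exact: cl'|exact: exprn_continuous].
  by apply: cvgM; [exact: cvg_cst|exact: cq].
- move=> x; have r1 : r x <= 1.
    by rewrite ge_max ler01 andbT lerBlDr lerDl exprn_ge0.
  by rewrite subr_ge0 exprn_ile1//= lerBlDr lerDl exprn_ge0.
split=> [x /andP[xa xb]|x].
  suff -> : r x = 0 by rewrite expr0n subr0.
  apply/max_idPr; rewrite subr_le0 -[leLHS](expr1n _ 3) lerXn2r// ?nnegrE//.
  rewrite /q /p le_max; apply/orP; left.
  rewrite /l ler_pdivlMr ?divr_gt0// mul1r.
  by nra.
rewrite negb_and -!leNgt => out.
have lx : l x <= 0.
  rewrite /l pmulr_lle0 ?invr_gt0 ?divr_gt0//.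
  by case/orP: out => ?; [apply: mulr_le0_ge0|apply: mulr_ge0_le0]; lra.
have qx : q x = 0 by exact/max_idPr.
have rx : r x = 1 by rewrite /r qx expr0n subr0; apply/max_idPl; exact: ler01.
by rewrite /q2 /q1 !qx !rx; split; ring.
Qed.
End cutoff.

(** * Test functions with prescribed values on a compact interval *)

Section extension.
Context {R : realType}.
Implicit Types (x y : R).

Lemma continuous_is_derive (f : R -> R) (x df : R) :
  is_derive x 1 f df -> {for x, continuous f}.
Proof.
by move=> h; apply: differentiable_continuous; apply/derivable1_diffP; have [] := h.
Qed.

Lemma bounded_compact_support (f : R -> R) (a b : R) : continuous f ->
  (forall x, ~~ (a < x < b) -> f x = 0) -> exists2 K, 0 <= K & forall x, `|f x| <= K.
Proof.
move=> cf van; have [ab|ba] := leP a b; last first.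
  exists 0 => // x; rewrite van ?normr0// negb_and -!leNgt.
  by case: (leP x a) => //= ax; apply: le_trans (ltW ba) (ltW ax).
have [|c _ hc] := @EVT_max _ (fun x => `|f x|) a b ab.
  apply: continuous_subspaceT => x.
  exact: (continuous_comp (cf x) (@norm_continuous _ _ _)).
exists `|f c| => // x; have [xab|/van ->] := boolP (a < x < b).
  by apply: hc; rewrite in_itv/=; case/andP: xab => /ltW -> /ltW.
by rewrite normr0.
Qed.

(** The test function is [chi * phi] with the cutoff above. It is applied to [hscale mu], whose
    generator is zero, and to the square function, whose generator is at least [1]. The last clause
    lets bounds and signs of [phi] pass to [f]. *)
Lemma bessel3_extension mu (phi phi1 phi2 : R -> R) (a0 b0 : R) :
  0 < a0 -> a0 <= b0 ->
  (forall x : R, 0 < x -> is_derive x 1 phi (phi1 x)) ->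
  (forall x : R, 0 < x -> is_derive x 1 phi1 (phi2 x)) ->
  (forall x : R, 0 < x -> {for x, continuous phi2}) ->
  exists f : R -> R,
  [/\ C2c_pos f,
      continuous (bessel3_generator mu f),
      exists2 K, 0 <= K & forall x, `|bessel3_generator mu f x| <= K,
      forall x, (a0 <= x <= b0 -> f x = phi x) /\
         (a0 < x < b0 -> bessel3_generator mu f x =
            2^-1 * phi2 x + hcos mu x / hsin mu x * phi1 x) &
      forall x, f x = 0 \/ a0 / 2 < x < b0 + 1 /\
         (exists2 c, 0 <= c <= 1 & f x = c * phi x)].
Proof.
move=> a00 ab dphi dphi1 cphi2.
have [chi [chi1 [chi2 [dchi dchi1 cchi2 chi01 [chi_1 chi_0]]]]] := cutoff_exists a00 ab.
have a20 : 0 < a0 / 2 by rewrite divr_gt0.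
have vanl x : x <= a0 / 2 -> [/\ chi x = 0, chi1 x = 0 & chi2 x = 0].
  by move=> xa; apply: chi_0; rewrite negb_and -leNgt xa.
pose f x := chi x * phi x.
pose f1 x := chi1 x * phi x + chi x * phi1 x.
pose f2 x := (chi2 x * phi x + chi1 x * phi1 x) + (chi1 x * phi1 x + chi x * phi2 x).
have df (x : R) : is_derive x 1 f (f1 x).
  by apply: (is_derive_mul_vanish a20) => // y /vanl[].
have df1 (x : R) : is_derive x 1 f1 (f2 x).
  apply: is_deriveD.
    by apply: (is_derive_mul_vanish a20) => // y /vanl[].
  by apply: (is_derive_mul_vanish a20) => // y /vanl[].
have cphi x : 0 < x -> {for x, continuous phi}.
  by move=> x0; exact: continuous_is_derive (dphi x x0).
have cphi1 x : 0 < x -> {for x, continuous phi1}.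
  by move=> x0; exact: continuous_is_derive (dphi1 x x0).
have cchi : continuous chi by move=> x; exact: continuous_is_derive (dchi x).
have cchi1 : continuous chi1 by move=> x; exact: continuous_is_derive (dchi1 x).
have cf2 : continuous f2.
  by move=> x; apply: cvgD; apply: cvgD;
     apply: (continuous_mul_vanish a20) => // y /vanl[].
have cf1 : continuous f1 by move=> x; exact: continuous_is_derive (df1 x).
have f'E : derive1 f = f1 by apply/funext => x; rewrite derive1E; have [] := df x.
have f''E : derive1 f1 = f2 by apply/funext => x; rewrite derive1E; have [] := df1 x.
have genE x : bessel3_generator mu f x =
    2^-1 * f2 x + f1 x * (hcos mu x / hsin mu x).
  rewrite /bessel3_generator f'E f''E; congr (_ + _).
  have [->|x0] := eqVneq x 0; last by rewrite bessel3_driftE// mulrC.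
  by rewrite /f1; have [-> -> _] := vanl 0 (ltW a20); rewrite !mul0r addr0 mulr0 mul0r.
have cgen : continuous (bessel3_generator mu f).
  have -> : bessel3_generator mu f = fun x => 2^-1 * f2 x + f1 x * (hcos mu x / hsin mu x).
    exact/funext.
  move=> x; apply: cvgD; first by apply: cvgM; [exact: cvg_cst|exact: cf2].
  apply: (continuous_mul_vanish a20) => // y.
    move=> y0; apply: cvgM; first exact: (continuous_is_derive (is_derive_hcos mu y)).
    apply: cvgV; first by rewrite gt_eqF// hsin_gt0.
    exact: (continuous_is_derive (is_derive_hsin mu y)).
  by move=> /vanl[e1 e2 _]; rewrite /f1 e1 e2 !mul0r addr0.
exists f; split => //.
- split=> [x|x||].
  + by have [] := df x.
  + by rewrite f'E; have [] := df1 x.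
  + by rewrite f'E f''E.
  + exists (a0 / 2), (b0 + 1); split => // x; apply: contraNT => xo.
    have [|e _ _] := chi_0 x; last by rewrite /f e mul0r.
    by apply: contra xo => /andP[/ltW-> /ltW->].
- apply: (@bounded_compact_support _ (a0 / 2) (b0 + 1)) => // x /chi_0[e e1 e2].
  by rewrite genE /f2 /f1 e e1 e2 !mul0r !addr0 mulr0 mul0r addr0.
- move=> x; split; first by move=> /chi_1 h; rewrite /f h mul1r.
  move=> xab; rewrite genE.
  have near1 : \forall z \near x, a0 < z < b0.
    have := xab => /andP[h1 h2]; near=> z; apply/andP; split; near: z.
      exact: lt_nbhsr.
    exact: lt_nbhsl.
  have c1 : chi1 x = 0.
    have [d <-] := dchi x; have <- : 'D_1 (cst (1 : R)) x = 0 by rewrite derive_cst.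
    apply: near_eq_derive; near=> z; apply: chi_1.
    by have /andP[/ltW -> /ltW ->] : a0 < z < b0 by near: z.
  have c11 : \forall z \near x, chi1 z = 0.
    have n2 : \forall z \near x, \forall t \near z, a0 < t < b0 by exact: near_join.
    near=> z.
    have [d <-] := dchi z; have <- : 'D_1 (cst (1 : R)) z = 0 by rewrite derive_cst.
    apply: near_eq_derive.
    have nz : \forall t \near z, a0 < t < b0 by near: z.
    near=> t; apply: chi_1.
    by have /andP[/ltW -> /ltW ->] : a0 < t < b0 by near: t.
  have c2 : chi2 x = 0.
    have [d <-] := dchi1 x; have <- : 'D_1 (cst (0 : R)) x = 0 by rewrite derive_cst.
    exact: near_eq_derive.
  have c0 : chi x = 1 by apply: chi_1; case/andP: xab => /ltW-> /ltW->.
  by rewrite /f2 /f1 c0 c1 c2; ring.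
move=> x; have [xo|/chi_0[e _ _]] := boolP (a0 / 2 < x < b0 + 1).
  by right; split=> //; exists (chi x).
by left; rewrite /f e mul0r.
Unshelve. all: by end_near. Qed.

End extension.

(** * The running maximum of a continuous path *)

Section runmax.
Context {R : realType}.
Variable X : R -> R.
Hypothesis cX : continuous X.
Implicit Types (s t r q : R).

(** Uniform continuity on a segment, with [t] allowed to leave the segment. Compactness is used as a
    near-covering property for the filter of positive [d] tending to [0]. *)
Lemma modulus_continuity (T e : R) : 0 < e ->
  exists2 d, 0 < d & forall s t, 0 <= s <= T -> `|s - t| < d -> `|X s - X t| < e.
Proof.
move=> e0.
have /compact_near_coveringP/(_ _ (0 : R)^'+
   (fun d s => forall t, `|s - t| < d -> `|X s - X t| < e)) := @segment_compact R 0 T.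
case.
  move=> x _; have e20 : 0 < e / 2 by rewrite divr_gt0.
  have /cvgrPdist_lt/(_ _ e20) := @cX x.
  move=> /nbhs_ballP[eta /= eta0 H].
  have eta20 : 0 < eta / 2 by rewrite divr_gt0.
  exists (ball x (eta / 2), [set d | d < eta / 2]).
    split; first exact: nbhsx_ballx.
    by near=> d; near: d; exact: nbhs_right_lt.
  move=> [y d] /= [yx de] t yt.
  have hy : `|X x - X y| < e / 2.
    by apply: H; apply: le_ball yx; lra.
  have ht : `|X x - X t| < e / 2.
    apply: H; rewrite /ball/= in yx *.
    rewrite (_ : x - t = (x - y) + (y - t)); last by ring.
    apply: le_lt_trans (ler_normD _ _) _.
    by rewrite (splitr eta) ltrD// (lt_trans yt).
  rewrite (_ : X y - X t = - (X x - X y) + (X x - X t)); last by ring.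
  apply: le_lt_trans (ler_normD _ _) _.
  by rewrite normrN (splitr e) ltrD.
move=> d /= d0 H.
exists (d / 2); first by rewrite divr_gt0.
move=> s t sT st; apply: (H (d / 2) _ _ s _ t st) => //=.
  by rewrite sub0r normrN gtr0_norm ?divr_gt0//; lra.
by rewrite divr_gt0.
Unshelve. all: by end_near. Qed.

(** Clipping the time at [0] gives a function on the whole line, equal to [X 0] at negative times,
    whose continuity can be stated without restriction to a half-line. *)
Definition runmax t := sup [set X r | r in `[0, Num.max t 0]].

Lemma runmax_attained t : 0 <= t -> exists q,
  [/\ 0 <= q <= t, runmax t = X q & forall r, 0 <= r <= t -> X r <= X q].
Proof.
move=> t0; have [|q qt hq] := @EVT_max _ X 0 t t0.
  exact: continuous_subspaceT.
exists q; split; first by move: qt; rewrite in_itv.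
  apply/eqP; rewrite eq_le /runmax (max_l t0); apply/andP; split.
    apply: ge_sup; first by exists (X q), q.
    by move=> _ [r rt <-]; exact: hq.
  apply: ub_le_sup; last by exists q.
  by exists (X q) => _ [r rt <-]; exact: hq.
by move=> r rt; apply: hq; rewrite in_itv.
Qed.

Lemma runmax_ge r t : 0 <= r <= t -> X r <= runmax t.
Proof.
move=> rt; have /runmax_attained[q [_ -> ]] : 0 <= t by case/andP: rt; exact: le_trans.
exact.
Qed.

Lemma runmax_le t c : 0 <= t -> (forall r, 0 <= r <= t -> X r <= c) -> runmax t <= c.
Proof. by move=> /runmax_attained[q [qt -> _]]; apply. Qed.

Lemma runmax0 t : t <= 0 -> runmax t = X 0.
Proof.
move=> t0; rewrite /runmax (max_r t0).
have [q []] := runmax_attained (lexx 0); rewrite -eq_le => /eqP <-.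
by rewrite /runmax maxxx.
Qed.

Lemma le_runmax s t : s <= t -> runmax s <= runmax t.
Proof.
move=> st; have [s0|s0] := leP 0 s; last first.
  rewrite (runmax0 (ltW s0)); have [t0|t0] := leP 0 t; last by rewrite (runmax0 (ltW t0)).
  by rewrite runmax_ge// lexx.
apply: runmax_le => // r /andP[r0 rs]; apply: runmax_ge; rewrite r0.
exact: le_trans rs st.
Qed.

(** If the maximum increases over a time step, it is attained within that step; this is how an
    increase of the maximum forces the path to be close to it. *)
Lemma runmax_local s t : 0 <= s -> s <= t ->
  runmax t = runmax s \/ exists2 q, s <= q <= t & runmax t = X q.
Proof.
move=> s0 st; have [q [/andP[q0 qt] e _]] := runmax_attained (le_trans s0 st).
have [qs|sq] := leP q s; last by right; exists q => //; rewrite qt (ltW sq).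
left; apply/eqP; rewrite eq_le (le_runmax st) andbT e runmax_ge//.
by rewrite q0.
Qed.

Lemma runmax_osc s t e : 0 <= s -> s <= t -> 0 <= e ->
  (forall r, s <= r <= t -> X r <= X s + e) -> runmax t <= runmax s + e.
Proof.
move=> s0 st e0 H; have [->|[q sqt ->]] := runmax_local s0 st.
  by rewrite lerDl.
by apply: le_trans (H _ sqt) _; rewrite lerD2r runmax_ge// s0/=.
Qed.

Lemma continuous_runmax : continuous runmax.
Proof.
move=> t; have [t0|t0] := ltP t 0.
  have H : (cst (X 0)) y @[y --> t] --> X 0 by exact: cvg_cst.
  rewrite /continuous_at runmax0 ?(ltW t0)//; apply: cvg_trans H.
  apply: near_eq_cvg; near=> z; rewrite runmax0//.
  by apply: ltW; near: z; exact: lt_nbhsl.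
apply/cvgrPdist_le => e e0.
have [d d0 H] := modulus_continuity (t + 1) e0.
near=> z.
have zd : `|t - z| < d by near: z; apply: cvgr_dist_lt; [exact: cvg_id|].
have z1 : `|t - z| < 1 by near: z; apply: cvgr_dist_lt; [exact: cvg_id|].
have zt1 : z <= t + 1 by move: z1; rewrite ltr_norml => /andP[]; lra.
have Hle s r : 0 <= s -> s <= r -> r <= t + 1 -> `|s - r| < d ->
    runmax r <= runmax s + e.
  move=> s0 sr rt srd; apply: runmax_osc => //; first exact: ltW.
  move=> q /andP[sq qr]; rewrite -lerBlDl.
  apply: le_trans (ler_norm _) _; apply/ltW/H; first by rewrite (le_trans s0)//= (le_trans qr).
  apply: le_lt_trans srd; rewrite ger0_norm ?subr_ge0// ler0_norm ?subr_le0// opprB.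
  by rewrite lerD2r.
have [tz|zt] := leP t z.
  rewrite ler0_norm ?subr_le0 ?le_runmax// opprB lerBlDl.
  exact: Hle.
rewrite ger0_norm ?subr_ge0 ?le_runmax ?(ltW zt)// lerBlDl.
have [z0|z0] := leP 0 z.
  by apply: Hle; rewrite ?(ltW zt)// ?lerDl// distrC.
rewrite (runmax0 (ltW z0)) -(runmax0 (lexx 0)); apply: Hle => //; first by rewrite lerDl.
move: zd; rewrite sub0r normrN (ger0_norm t0) => zd.
apply: le_lt_trans zd; apply: le_trans (ler_norm _); lra.
Unshelve. all: by end_near. Qed.

End runmax.

(** * Regularity and monotonicity of the scale function and of the weights *)

Section scale_estimates.
Context {R : realType}.
Variables (mu u : R).
Hypothesis u0 : 0 < u.

Lemma within_itv_is_derive (f df : R -> R) (a b : R) :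
  (forall x : R, a <= x <= b -> is_derive x 1 f (df x)) -> {within `[a, b], continuous f}.
Proof.
move=> H; apply: derivable_within_continuous => x; rewrite in_itv/= => /H[].
by [].
Qed.

Lemma increment_is_derive (f df : R -> R) (a b : R) : a <= b ->
  (forall x : R, a <= x <= b -> is_derive x 1 f (df x)) ->
  exists2 c, a <= c <= b & f b - f a = df c * (b - a).
Proof.
move=> ab H; have cf := within_itv_is_derive H.
have H' (x : R) : x \in `]a, b[ -> is_derive x 1 f (df x).
  by rewrite in_itv/= => /andP[/ltW ax /ltW xb]; apply: H; rewrite ax.
have [c cab e] := MVT_segment ab H' cf.
by exists c => //; move: cab; rewrite in_itv.
Qed.

Lemma hscale_lipschitz (a b : R) : 0 < a -> exists2 K, 0 <= K &
  forall x y, a <= x <= b -> a <= y <= b -> `|hscale mu x - hscale mu y| <= K * `|x - y|.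
Proof.
move=> a0; have [ab|ba] := leP a b; last first.
  by exists 0 => // x y /andP[ax xb]; move: (lt_le_trans (le_lt_trans xb ba) ax); rewrite ltxx.
have [|c cab hc] := @EVT_max _ (fun x => hsin mu x ^- 2) a b ab.
  apply: (@within_itv_is_derive _ (fun x => - 2 * hcos mu x / hsin mu x ^+ 3)) => x /andP[ax _].
  exact/is_derive_hscale'/(lt_le_trans a0).
exists (hsin mu c ^- 2); first by rewrite invr_ge0 sqr_ge0.
have main x y : a <= x <= b -> a <= y <= b -> x <= y ->
    `|hscale mu x - hscale mu y| <= hsin mu c ^- 2 * `|x - y|.
  move=> /andP[ax xb] /andP[ay yb] xy.
  have dz (z : R) : x <= z <= y -> is_derive z 1 (hscale mu) (hsin mu z ^- 2).
    by move=> /andP[xz _]; apply: is_derive_hscale; apply: lt_le_trans (le_trans ax xz).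
  have [z zxy e] := increment_is_derive xy dz.
  rewrite distrC e normrM [`|x - y|]distrC ler_wpM2r// ger0_norm ?invr_ge0 ?sqr_ge0//.
  by apply: hc; move: zxy; rewrite in_itv/= => /andP[xz zy]; rewrite (le_trans ax)// (le_trans zy).
move=> x y hx hy; have [xy|/ltW yx] := leP x y; first exact: main.
by rewrite distrC [`|x - y|]distrC; exact: main.
Qed.

(** For fixed [x] the derivative in [y] of [wgt y * hscale x + off y] is
    [wgt' y * (hscale x - hscale y)], which is of order [e] when [y] is within [e] of [x]. The
    increment is thus of second order, and its sum over a fine grid tends to zero. *)
Lemma wgt_off_increment (a b : R) : 0 < a -> exists2 L, 0 <= L &
  forall x m m' e, a <= x <= b -> a <= m -> m <= m' -> m' <= b ->
    (forall y, m <= y <= m' -> `|x - y| <= e) ->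
  `|(wgt mu u m' - wgt mu u m) * hscale mu x + (off mu u m' - off mu u m)|
    <= L * e * (m' - m).
Proof.
move=> a0; have [ab|ba] := leP a b; last first.
  by exists 0 => // x m m' e /andP[ax xb]; move: (lt_le_trans (le_lt_trans xb ba) ax); rewrite ltxx.
have [K K0 lipK] := hscale_lipschitz b a0.
pose dw y := expR (kappa mu u * y) * hsin mu y / hsin mu u ^+ 2.
have su := hsin_gt0 mu u0.
have dw0 y : 0 < y -> 0 <= dw y.
  by move=> y0; rewrite divr_ge0 ?sqr_ge0// mulr_ge0 ?expR_ge0// ltW// hsin_gt0.
have [|c cab hc] := @EVT_max _ dw a b ab.
  apply: continuous_subspaceT => y.
  have c1 : {for y, continuous (hsin mu)} by exact: continuous_is_derive (is_derive_hsin mu y).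
  have c2 : {for y, continuous (fun y => expR (kappa mu u * y))}.
    apply: (@continuous_comp _ _ _ (fun y => kappa mu u * y) expR); last exact: continuous_expR.
    by apply: cvgM; [exact: cvg_cst|exact: cvg_id].
  exact: (cvgM (cvgM c2 c1) (cvg_cst (hsin mu u ^+ 2)^-1)).
have c0 : 0 < c by move: cab; rewrite in_itv/= => /andP[ac _]; apply: lt_le_trans ac.
exists (dw c * K); first by rewrite mulr_ge0// dw0.
move=> x m m' e axb am mm' m'b H.
pose G y := wgt mu u y * hscale mu x + off mu u y.
pose dG y := dw y * (hscale mu x - hscale mu y).
have dGE (y : R) : m <= y <= m' -> is_derive y 1 G (dG y).
  move=> /andP[my _]; have y0 : 0 < y := lt_le_trans a0 (le_trans am my).
  have d1 := is_derive_wgt mu u0 y; have d2 := is_derive_off mu u0 y.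
  rewrite /G; apply: is_derive_eq; rewrite /GRing.scale /= /dG /dw /hscale.
  have x0 : 0 < x by case/andP: axb => ax _; exact: lt_le_trans ax.
  by field; rewrite !gt_eqF ?hsin_gt0.
have [z zmm e'] := increment_is_derive mm' dGE.
have -> : (wgt mu u m' - wgt mu u m) * hscale mu x + (off mu u m' - off mu u m) = G m' - G m.
  by rewrite /G; ring.
have azb : a <= z <= b by case/andP: zmm => mz zm'; rewrite (le_trans am)//= (le_trans zm').
have z0 : 0 < z by case/andP: azb => az _; exact: lt_le_trans az.
have e0 : 0 <= e by apply: le_trans (H z zmm).
rewrite e' normrM (@ger0_norm _ (m' - m)) ?subr_ge0// ler_wpM2r ?subr_ge0//.
rewrite /dG normrM (ger0_norm (dw0 _ z0)) -[leRHS]mulrA.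
apply: ler_pM; [exact: dw0|exact: normr_ge0| |].
  by apply: hc; rewrite in_itv.
by apply: le_trans (lipK _ _ axb azb) _; rewrite ler_wpM2l// H.
Qed.

Lemma ler_wgt (m m' : R) : 0 <= m -> m <= m' -> wgt mu u m <= wgt mu u m'.
Proof.
move=> m0 mm'; pose dw y := expR (kappa mu u * y) * hsin mu y / hsin mu u ^+ 2.
have dE (y : R) : m <= y <= m' -> is_derive y 1 (wgt mu u) (dw y).
  by move=> _; exact: is_derive_wgt.
have [z zmm e'] := increment_is_derive mm' dE.
rewrite -subr_ge0 e' mulr_ge0 ?subr_ge0//.
rewrite divr_ge0 ?sqr_ge0// mulr_ge0 ?expR_ge0//.
move: zmm => /andP[mz _]; have := le_trans m0 mz.
by rewrite le_eqVlt => /predU1P[<-|/(hsin_gt0 mu)/ltW//]; rewrite hsin0.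
Qed.

Lemma ler_off (m m' : R) : m <= m' -> off mu u m <= off mu u m'.
Proof.
move=> mm'; pose dw y := expR (kappa mu u * y) * hcos mu y / hsin mu u ^+ 2.
have dE (y : R) : m <= y <= m' -> is_derive y 1 (off mu u) (dw y).
  by move=> _; exact: is_derive_off.
have [z zmm e'] := increment_is_derive mm' dE.
rewrite -subr_ge0 e' mulr_ge0 ?subr_ge0//.
by rewrite divr_ge0 ?sqr_ge0// mulr_ge0 ?expR_ge0// ltW// hcos_gt0.
Qed.

Lemma continuous_wgt : continuous (wgt mu u).
Proof. by move=> x; exact: continuous_is_derive (is_derive_wgt mu u0 x). Qed.

Lemma continuous_off : continuous (off mu u).
Proof. by move=> x; exact: continuous_is_derive (is_derive_off mu u0 x). Qed.

End scale_estimates.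

(** * Stopped paths *)

Section stopping.
Context {R : realType}.
Variables (u v beta : R) (X : R -> R).
Hypothesis cX : continuous X.
Implicit Types (s t r : R).

(* Nonnegative iff, at time [r], the running maximum is at least [beta], or it is at
   least [v] and exceeds [X r] by at least [u]. *)
Definition deadline r :=
  Num.max (runmax X r - beta) (Num.min (runmax X r - v) (runmax X r - X r - u)).

Definition alive t := forall r, 0 <= r <= t -> deadline r < 0.

Lemma continuous_deadline : continuous deadline.
Proof.
have cS := continuous_runmax cX.
have h1 c : continuous (fun r => runmax X r - c).
  by move=> x; apply: cvgB; [exact: cS|exact: cvg_cst].
have h2 : continuous (fun r => runmax X r - X r - u).
  by move=> x; apply: cvgB; [apply: cvgB; [exact: cS|exact: cX]|exact: cvg_cst].
move=> x; apply: (@continuous_max _ _ (fun r => runmax X r - beta)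
  (fun r => Num.min (runmax X r - v) (runmax X r - X r - u))); first exact: h1.
by apply: (@continuous_min _ _ (fun r => runmax X r - v)
  (fun r => runmax X r - X r - u)); [exact: h1|exact: h2].
Qed.

Lemma alive_le s t : s <= t -> alive t -> alive s.
Proof.
by move=> st at_ r /andP[r0 rs]; apply: at_; rewrite r0 (le_trans rs).
Qed.

Lemma deadline_lt0 r : (deadline r < 0) =
  (runmax X r < beta) && ((runmax X r < v) || (runmax X r - X r < u)).
Proof. by rewrite /deadline gt_max gt_min !subr_lt0. Qed.

(** The first time at which [deadline] is nonnegative, capped at [T]. Adding [r = 0] keeps the set
    nonempty when the path is dead at the start. *)
Definition stopping T := sup [set r | 0 <= r <= T /\ (r = 0 \/ alive r)].

Lemma stopping_itv T : 0 <= T -> 0 <= stopping T <= T.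
Proof.
move=> T0; apply/andP; split.
  apply: ub_le_sup; first by exists T => r /= [/andP[]].
  by split; [rewrite lexx|left].
apply: ge_sup; first by exists 0; split; [rewrite lexx|left].
by move=> r /= [/andP[]].
Qed.

Lemma alive_le_stopping T t : 0 <= t <= T -> alive t -> t <= stopping T.
Proof.
move=> tT at_; apply: ub_le_sup; first by exists T => r /= [/andP[]].
by split=> //; right.
Qed.

Lemma lt_stopping_alive T t : 0 <= T -> t < stopping T -> alive t.
Proof.
move=> T0; have hs : has_sup [set r | 0 <= r <= T /\ (r = 0 \/ alive r)].
  split; first by exists 0; split; [rewrite lexx|left].
  by exists T => r /= [/andP[]].
move=> tT; have [r [rT] [->|ar] tr] := sup_gt hs.1 tT.
  by move=> q /andP[q0 /le_lt_trans/(_ tr)]; rewrite ltNge q0.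
exact: alive_le (ltW tr) ar.
Qed.

(** Otherwise [deadline] would stay negative a little longer by continuity, and the path would still
    be alive after [stopping T]. *)
Lemma stopping_dead T : 0 <= T -> stopping T < T -> 0 <= deadline (stopping T).
Proof.
move=> T0 sT; rewrite leNgt; apply/negP => dl.
have [s0 _] := andP (stopping_itv T0).
have := @continuous_deadline (stopping T).
move=> /cvgrPdist_lt/(_ (- deadline (stopping T))); rewrite oppr_gt0 => /(_ dl).
move=> /nbhs_ballP[d /= d0 H].
pose t := Num.min T (stopping T + d / 2).
have st : stopping T < t.
  by rewrite lt_min sT/= ltrDl divr_gt0.
have tT : t <= T by rewrite ge_min lexx.
suff at_ : alive t.
  have tT0 : 0 <= t <= T by rewrite tT (le_trans s0 (ltW st)).
  by have := alive_le_stopping tT0 at_; rewrite leNgt st.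
move=> r /andP[r0 rt]; have [/(lt_stopping_alive T0)|sr] := ltP r (stopping T).
  by apply; rewrite r0 lexx.
have : ball (stopping T) d r.
  rewrite /ball /= ler0_norm ?subr_le0// opprB.
  move: rt; rewrite le_min => /andP[_ rd]; lra.
move=> /H /=; rewrite ltr_norml => /andP[h _]; lra.
Qed.

End stopping.

(** * Time integrals, summation by parts and truncated sums *)

Section increments.
Context {R : realType}.

Lemma Rintegral_increment (g : R -> R) (s t : R) : continuous g -> 0 <= s -> s <= t ->
  \int[lebesgue_measure]_(r in `[0, t]) g r - \int[lebesgue_measure]_(r in `[0, s]) g r =
  \int[lebesgue_measure]_(r in `]s, t]) g r.
Proof.
move=> cg s0 st; rewrite Rintegral_itvB ?bnd_simp//.
apply: continuous_compact_integrable; first exact: segment_compact.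
exact: continuous_subspaceT.
Qed.

Lemma Rintegral_bounds (g : R -> R) (s t a b : R) : continuous g -> 0 <= s -> s <= t ->
  (forall r, s <= r <= t -> a <= g r <= b) ->
  a * (t - s) <= \int[lebesgue_measure]_(r in `[0, t]) g r -
    \int[lebesgue_measure]_(r in `[0, s]) g r <= b * (t - s).
Proof.
move=> cg s0 st H; rewrite Rintegral_increment//.
have mE : fine (lebesgue_measure (`]s, t] : set R)) = t - s.
  by rewrite lebesgue_measure_itv/= lte_fin; case: ltgtP st => // ->; rewrite subrr.
have ig (f : R -> R) : continuous f -> lebesgue_measure.-integrable `]s, t] (EFin \o f).
  move=> cf; apply: (@integrableS _ _ _ lebesgue_measure `[s, t]) => //.
    exact: subset_itv_oc_cc.
  apply: continuous_compact_integrable; first exact: segment_compact.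
  exact: continuous_subspaceT.
have icst (c : R) : lebesgue_measure.-integrable `]s, t] (EFin \o cst c).
  by apply: ig => x; exact: cvg_cst.
rewrite -mE -!Rintegral_cst//; apply/andP; split; apply: le_Rintegral => //;
  try exact: ig; try exact: icst.
  by move=> x /= /subset_itv_oc_cc; rewrite in_itv/= => /H/andP[].
by move=> x /= /subset_itv_oc_cc; rewrite in_itv/= => /H/andP[].
Qed.

(* Summation by parts: the bound does not depend on the number of terms. *)
Lemma abel_bound (w N : nat -> R) (K A : R) (J : nat) :
  (forall j, `|N j| <= K) ->
  (forall j, (j < J)%N -> 0 <= w j <= A) ->
  (forall j, (j.+1 < J)%N -> w j <= w j.+1) ->
  0 <= A ->
  `|\sum_(j < J) w j * (N j.+1 - N j)| <= 2 * K * A.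
Proof.
move=> NK w0 wle A0; have K0 : 0 <= K by apply: le_trans (NK 0).
case: J w0 wle => [|J] w0 wle; first by rewrite big_ord0 normr0 !mulr_ge0.
(* Once the boundary term is removed, each step adds [(w k - w k.+1) * N k.+1] to the sum; since [w]
   is nondecreasing, these terms cost at most [K] times the growth of [w]. *)
have H : forall k, (k <= J)%N ->
    `|\sum_(j < k.+1) w j * (N j.+1 - N j) - w k * N k.+1| <= K * w k.
  elim=> [|k IH] kJ.
    rewrite big_ord_recl big_ord0/= addr0.
    rewrite (_ : _ - _ = - (w 0%N * N 0%N)); last by ring.
    have /andP[w00 _] := w0 0%N isT.
    by rewrite normrN normrM (ger0_norm w00) mulrC ler_wpM2r.
  have wk : w k <= w k.+1 by apply: wle; rewrite ltnS.
  rewrite big_ord_recr/=.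
  set S := \sum_(j < k.+1) _ in IH *.
  rewrite (_ : _ - _ = (S - w k * N k.+1) + (w k - w k.+1) * N k.+1); last by ring.
  apply: le_trans (ler_normD _ _) _.
  apply: (@le_trans _ _ (K * w k + (w k.+1 - w k) * K));
    last by rewrite le_eqVlt; apply/orP; left; apply/eqP; ring.
  apply: lerD; first exact/IH/ltnW.
  by rewrite normrM ler0_norm ?subr_le0// opprB ler_wpM2l// subr_ge0.
have := H J (leqnn _); set S := \sum_(j < J.+1) _ => HJ.
have /andP[wJ0 wJA] := w0 J (ltnSn _).
rewrite (_ : S = (S - w J * N J.+1) + w J * N J.+1); last by ring.
apply: le_trans (ler_normD _ _) _; rewrite (_ : 2 * K * A = K * A + A * K); last by ring.
apply: lerD; first by apply: le_trans HJ _; rewrite ler_wpM2l.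
by rewrite normrM ler_pM// ger0_norm.
Qed.

(** Links two forms of the same sum: with indicators and a fixed number of terms it can be
    integrated term by term, while with [J] terms, [J] depending on the path, it telescopes. *)
Lemma sum_downward_closed (V : nmodType) (P : nat -> bool) (n : nat) :
  (forall i j, (i <= j)%N -> P j -> P i) ->
  exists J, [/\ (J <= n)%N, forall j, (j < J)%N -> P j, (J < n)%N -> ~~ P J &
    forall F : nat -> V, \sum_(j < n) (if P j then F j else 0) = \sum_(j < J) F j]%R.
Proof.
move=> Pd; elim: n => [|n [J [Jn PJ nPJ HJ]]].
  by exists 0%N; split => // F; rewrite !big_ord0.
have [Jlt|] := ltnP J n.
  exists J; split => //; first exact: ltnW.
    by move=> _; exact: nPJ.
  move=> F; rewrite big_ord_recr/= HJ ifF ?addr0//.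
  by apply/negbTE; apply: contra (nPJ Jlt); apply: Pd; exact: ltnW.
move=> nJ; have {Jn nJ} eJ : J = n by apply/eqP; rewrite eqn_leq Jn.
subst J; have [Pn|nPn] := boolP (P n).
  exists n.+1; split => //.
    by move=> j jn; apply: Pd Pn; rewrite -ltnS.
    by rewrite ltnn.
  by move=> F; rewrite big_ord_recr/= HJ Pn [in RHS]big_ord_recr.
exists n; split => //.
by move=> F; rewrite big_ord_recr/= HJ (negbTE nPn) addr0.
Qed.

End increments.

(** * Pathwise convergence of the Riemann sums *)

Section pathwise.
Context {R : realType}.
Variables (mu u v beta : R) (f h : R -> R) (X : R -> R).
Implicit Types (s t r : R).

Definition vmax t := Num.max v (runmax X t).
(* The subtracted constant makes [weight] vanish until [X] has reached the level
   [v], so that [f] needs to agree with [hscale] only away from [0]. *)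
Definition weight t := wgt mu u (vmax t) - wgt mu u v.
(** Where [f] agrees with [hscale], this is [F(X, S \/ v) - wgt v * hscale X]: the correction tends
    to zero with [wgt v] when [v] decreases to [u]. *)
Definition potential t := weight t * f (X t) + off mu u (vmax t).
Definition compensated t :=
  f (X t) - f (X 0) - \int[lebesgue_measure]_(r in `[0, t]) h (X r).
Definition grid (n j : nat) : R := j%:R / n.+1%:R.
Definition alive_weight t := if `[< alive u v beta X t >] then weight t else 0.
Definition riemann_sum (T n : nat) := \sum_(j < (T * n.+1)%N)
  alive_weight (grid n j) * (compensated (grid n j.+1) - compensated (grid n j)).

Hypotheses (u0 : 0 < u) (uv : u < v) (vbeta : v < beta).
Hypotheses (cf : continuous f) (ch : continuous h) (cX : continuous X).
Hypothesis fE : forall x, (v - u) / 2 <= x <= beta + 1 -> f x = hscale mu x.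
Hypothesis hE : forall x, (v - u) / 2 < x < beta + 1 -> h x = 0.

Lemma le_vmax s t : s <= t -> vmax s <= vmax t.
Proof. by move=> st; rewrite ge_max !le_max lexx/= (le_runmax cX st) orbT. Qed.

Lemma vmax_ge t : v <= vmax t.
Proof. by rewrite le_max lexx. Qed.

Lemma continuous_vmax : continuous vmax.
Proof.
move=> x; apply: (@continuous_max _ _ (cst v) (runmax X)); first exact: cvg_cst.
exact: continuous_runmax.
Qed.

Lemma continuous_potential : continuous potential.
Proof.
move=> x.
have c1 : {for x, continuous (fun t => off mu u (vmax t))}.
  apply: (@continuous_comp _ _ _ vmax (off mu u)); first exact: continuous_vmax.
  exact: continuous_off.
have c2 : {for x, continuous (fun t => wgt mu u (vmax t))}.
  apply: (@continuous_comp _ _ _ vmax (wgt mu u)); first exact: continuous_vmax.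
  exact: continuous_wgt.
have c3 : {for x, continuous (fun t => f (X t))}.
  by apply: (@continuous_comp _ _ _ X f); [exact: cX|exact: cf].
exact: (cvgD (cvgM (cvgB c2 (cvg_cst (wgt mu u v))) c3) c1).
Qed.

Lemma le_weight s t : s <= t -> weight s <= weight t.
Proof.
move=> st; rewrite lerD2r ler_wgt ?le_vmax//.
by apply: le_trans (vmax_ge s); apply: ltW (lt_trans u0 uv).
Qed.

Lemma weight_ge0 t : 0 <= weight t.
Proof. by rewrite subr_ge0 ler_wgt ?vmax_ge// ltW// (lt_trans u0). Qed.

Lemma alive_weight_le t : 0 <= t -> alive u v beta X t ->
  weight t <= wgt mu u beta - wgt mu u v.
Proof.
move=> t0 /(_ t); rewrite lexx t0 deadline_lt0 => /(_ isT)/andP[Sb _].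
rewrite lerD2r ler_wgt//; first by apply: le_trans (vmax_ge t); exact: ltW (lt_trans u0 uv).
by rewrite ge_max !ltW.
Qed.

(** While the maximum is at most [v] the weight is zero. Afterwards being alive gives
    [v - u < X s < beta], and an oscillation below [e] keeps the path, during the step, in the
    window where [h = 0] and only [f] contributes. What remains is a [wgt_off_increment] at
    [x = X t]; it is nonzero only if [vmax] moves, and then every level between [vmax s] and
    [vmax t] is within [e] of [X t]. The bound telescopes when summed over steps. *)
Lemma step_estimate : exists2 L, 0 <= L & forall s t e,
  0 <= s -> s <= t -> 0 < e -> e <= (v - u) / 2 -> e <= 1 ->
  (forall r r', s <= r <= t -> s <= r' <= t -> `|X r - X r'| < e) ->
  alive u v beta X s ->
  `|weight s * (compensated t - compensated s) - (potential t - potential s)|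
    <= L * e * (vmax t - vmax s).
Proof.
have a0 : 0 < (v - u) / 2 by rewrite divr_gt0// subr_gt0.
have [L L0 HL] := wgt_off_increment mu u0 (beta + 1) a0.
exists L => // s t e s0 st e0 ea e1 osc al.
have dl : deadline u v beta X s < 0 by apply: al; rewrite s0 lexx.
have sst : s <= s <= t by rewrite lexx.
have tst : s <= t <= t by rewrite lexx andbT.
have incr : weight s * (compensated t - compensated s) = weight s * (f (X t) - f (X s)).
  have [Sv|vS] := leP (runmax X s) v.
    by rewrite /weight /vmax (max_l Sv) subrr !mul0r.
  congr (_ * _).
  have : `|\int[lebesgue_measure]_(r in `[0, t]) h (X r) -
           \int[lebesgue_measure]_(r in `[0, s]) h (X r)| <= 0.
    move: dl; rewrite deadline_lt0 (ltNge _ v) (ltW vS)/= => /andP[Sb SX].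
    have XS : X s <= runmax X s by apply: runmax_ge => //; rewrite s0 lexx.
    have cg : continuous (fun r => h (X r)).
      by move=> x; apply: continuous_comp; [exact: cX|exact: ch].
    have h0 r : s <= r <= t -> 0 <= h (X r) <= 0.
      move=> rst; rewrite hE ?lexx//.
      have := osc _ _ rst sst; rewrite ltr_norml => /andP[i1 i2].
      apply/andP; split; lra.
    have := Rintegral_bounds cg s0 st h0.
    by rewrite !mul0r ler_norml oppr0.
  rewrite normr_le0 subr_eq0 => /eqP e'.
  by rewrite /compensated e'; ring.
rewrite incr.
have -> : weight s * (f (X t) - f (X s)) - (potential t - potential s) =
    - ((wgt mu u (vmax t) - wgt mu u (vmax s)) * f (X t) +
       (off mu u (vmax t) - off mu u (vmax s))).
  by rewrite /potential /weight; ring.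
rewrite normrN.
have [E|] := eqVneq (vmax t) (vmax s).
  by rewrite E !subrr mul0r addr0 normr0 mulr0.
move=> neq.
have lt : vmax s < vmax t by rewrite lt_neqAle eq_sym neq le_vmax.
have SvE : vmax t = runmax X t.
  apply: max_r; rewrite leNgt; apply/negP => h1.
  have : vmax t = v by apply: max_l; exact: ltW.
  by move=> h2; move: lt; rewrite h2 ltNge vmax_ge.
have [q qst SqE] : exists2 q, s <= q <= t & runmax X t = X q.
  have [E|//] := runmax_local cX s0 st.
  by move: lt; rewrite SvE E ltNge /vmax le_max lexx orbT.
have XtS : X t <= runmax X t.
  by apply: runmax_ge => //; rewrite lexx (le_trans s0).
have XsS : X s <= vmax s.
  by rewrite le_max (@runmax_ge _ X cX s s) ?orbT// lexx s0.
have Xqt : X q - X t < e by apply: le_lt_trans (ler_norm _) (osc _ _ qst tst).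
have Xqs : X q - X s < e by apply: le_lt_trans (ler_norm _) (osc _ _ qst sst).
have vs := vmax_ge s.
have Ss : vmax s <= beta.
  by rewrite ge_max (ltW vbeta)/=; move: dl; rewrite deadline_lt0 => /andP[/ltW].
have vpos := u0.
rewrite fE; last by apply/andP; split; lra.
apply: HL.
- by apply/andP; split; lra.
- by lra.
- exact: le_vmax.
- by lra.
move=> y /andP[ys yt]; rewrite ler_norml; apply/andP; split; lra.
Qed.

Lemma compensated_bound (F H T : R) : 0 <= H -> (forall x, `|f x| <= F) ->
  (forall x, `|h x| <= H) -> forall t, 0 <= t <= T -> `|compensated t| <= 2 * F + H * T.
Proof.
move=> H0 fF hH t /andP[t0 tT].
have cg : continuous (fun r => h (X r)).
  by move=> x; apply: continuous_comp; [exact: cX|exact: ch].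
have := @Rintegral_bounds _ (fun r => h (X r)) 0 t (- H) H cg (lexx 0) t0.
rewrite set_itv1 Rintegral_set1 !subr0 mulNr -ler_norml => I1.
apply: le_trans (ler_normB _ _) _; apply: lerD.
  by apply: le_trans (ler_normB _ _) _; rewrite mulr2n mulrDl mul1r lerD.
apply: (@le_trans _ _ (H * t)); last by rewrite ler_wpM2l.
by apply: I1 => r _; rewrite -ler_norml.
Qed.

Lemma grid_ge0 n j : 0 <= grid n j.
Proof. by rewrite divr_ge0. Qed.

Lemma le_grid n i j : (i <= j)%N -> grid n i <= grid n j.
Proof. by move=> ij; rewrite ler_pM2r ?invr_gt0// ler_nat. Qed.

Lemma grid_max T n : grid n (T * n.+1)%N = T%:R.
Proof. by rewrite /grid natrM mulfK// pnatr_eq0. Qed.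

Lemma gridS n j : grid n j.+1 = grid n j + n.+1%:R^-1.
Proof. by rewrite /grid -natr1 mulrDl mul1r. Qed.

Lemma riemann_sumE T n : exists J, [/\ (J <= T * n.+1)%N,
  forall j, (j < J)%N -> alive u v beta X (grid n j),
  (J < T * n.+1)%N -> ~ alive u v beta X (grid n J) &
  riemann_sum T n = \sum_(j < J)
    weight (grid n j) * (compensated (grid n j.+1) - compensated (grid n j))].
Proof.
have [|J [Jn PJ nPJ HJ]] := @sum_downward_closed R
    (fun j => `[< alive u v beta X (grid n j) >]) (T * n.+1)%N.
  by move=> i j ij /asboolP /(alive_le (le_grid n ij)) ?; apply/asboolP.
exists J; split => //.
- by move=> j /PJ/asboolP.
- by move=> /nPJ /asboolP.
rewrite -(HJ (fun j => weight (grid n j) *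
  (compensated (grid n j.+1) - compensated (grid n j)))).
apply: eq_bigr => j _; rewrite /alive_weight.
by case: ifP; rewrite ?mul0r.
Qed.

Lemma riemann_sum_bound (F H : R) (T n : nat) : 0 <= H -> (forall x, `|f x| <= F) ->
  (forall x, `|h x| <= H) ->
  `|riemann_sum T n| <= 2 * (2 * F + H * T%:R) * (wgt mu u beta - wgt mu u v).
Proof.
move=> H0 fF hH; have [J [Jn PJ _ ->]] := riemann_sumE T n.
(* [abel_bound] requires a bound on all terms of the sequence, whereas [compensated] is bounded only
   up to time [T]; capping the index supplies it without changing the sum. *)
have -> : \sum_(j < J) weight (grid n j) * (compensated (grid n j.+1) - compensated (grid n j)) =
    \sum_(j < J) weight (grid n j) * (compensated (grid n (minn j.+1 (T * n.+1))) -
      compensated (grid n (minn j (T * n.+1)))).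
  apply: eq_bigr => j _; rewrite !(minn_idPl _)//.
    exact: leq_trans (ltnW (ltn_ord j)) Jn.
  exact: leq_trans (ltn_ord j) Jn.
apply: (@abel_bound _ (fun j => weight (grid n j))
   (fun j => compensated (grid n (minn j (T * n.+1))))).
- move=> j; apply: compensated_bound => //; rewrite grid_ge0 -(grid_max T n).
  by rewrite le_grid// geq_minr.
- by move=> j jJ; rewrite weight_ge0/= alive_weight_le ?grid_ge0//; exact: PJ.
- by move=> j _; rewrite le_weight// le_grid.
by rewrite subr_ge0 ler_wgt// ltW// (lt_trans u0).
Qed.

Lemma cvg_riemann_sum (T : nat) :
  riemann_sum T n @[n --> \oo] -->
    potential (stopping u v beta X T%:R) - potential 0.
Proof.
have [L L0 HL] := step_estimate.
set th := stopping u v beta X T%:R.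
have T0 : 0 <= T%:R :> R by [].
have /andP[th0 thT] := stopping_itv u v beta X T0; rewrite -/th in th0 thT.
apply/cvgrPdist_le => e e0.
have e20 : 0 < e / 2 by rewrite divr_gt0.
have := @continuous_potential th => /cvgrPdist_lt/(_ _ e20)/nbhs_ballP[d1 /= d10 Hd1].
(* [e1 * C] bounds the sum of the step errors, since the increments of [vmax] telescope; the added
   [1] makes [C] positive. *)
pose C := L * (vmax T%:R - vmax 0) + 1.
have C0 : 0 < C by rewrite ltr_wpDl// mulr_ge0// subr_ge0 le_vmax.
pose e1 := Num.min (Num.min ((v - u) / 2) 1) (e / 2 / C).
have e10 : 0 < e1 by rewrite !lt_min ltr01 !divr_gt0// subr_gt0.
have [d2 d20 Hd2] := modulus_continuity cX T%:R e10.
near=> n.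
have nd1 : n.+1%:R^-1 < d1 by near: n; exact: near_infty_natSinv_lt (PosNum d10).
have nd2 : n.+1%:R^-1 < d2 by near: n; exact: near_infty_natSinv_lt (PosNum d20).
have [J [Jn PJ nPJ ->]] := riemann_sumE T n.
have JT : grid n J <= T%:R by rewrite -(grid_max T n) le_grid.
(* The grid point [J] is the first dead one, or the last of the grid, and so lies between [th] and
   [th + 1 / (n + 1)]. *)
have pJ : `|potential th - potential (grid n J)| < e / 2.
  apply: Hd1; rewrite /ball /= ler0_norm; last first.
    rewrite subr_le0; have := Jn; rewrite leq_eqVlt => /predU1P[->|].
      by rewrite grid_max.
    move=> /nPJ nal; rewrite leNgt; apply/negP => /(lt_stopping_alive T0).
    exact: nal.
  rewrite opprB; apply: le_lt_trans nd1; rewrite lerBlDl.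
  case: J Jn PJ {nPJ} JT => [|J] Jn PJ JT; first by rewrite /grid mul0r addr_ge0.
  rewrite gridS lerD2r; apply: alive_le_stopping; last exact: PJ.
  by rewrite grid_ge0/=; apply: le_trans JT; rewrite le_grid.
have telo (g : R -> R) : g (grid n J) - g 0 = \sum_(j < J) (g (grid n j.+1) - g (grid n j)).
  rewrite -(big_mkord xpredT (fun j => g (grid n j.+1) - g (grid n j))).
  by rewrite telescope_sumr// /grid mul0r.
have sJ : `|\sum_(j < J) weight (grid n j) * (compensated (grid n j.+1) - compensated (grid n j)) -
    (potential (grid n J) - potential 0)| <= e / 2.
  rewrite telo -sumrB; apply: le_trans (ler_norm_sum _ _ _) _.
  apply: (@le_trans _ _ (\sum_(j < J) L * e1 * (vmax (grid n j.+1) - vmax (grid n j)))).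
    apply: ler_sum => j _; apply: HL.
    - exact: grid_ge0.
    - exact: le_grid.
    - by [].
    - by rewrite !ge_min lexx.
    - by rewrite !ge_min lexx orbT.
    - move=> r r' /andP[rj rj'] /andP[r'j r'j']; apply: Hd2.
        rewrite (le_trans (grid_ge0 n j) rj)/= (le_trans rj')//.
        by apply: le_trans JT; exact: le_grid.
      apply: le_lt_trans nd2.
      move: rj rj' r'j r'j'; rewrite gridS ler_norml.
      move: (grid n j) (n.+1%:R^-1) => a c *.
      apply/andP; split; lra.
    - exact: PJ.
  rewrite -mulr_sumr -telo.
  apply: (@le_trans _ _ (e1 * C)).
    rewrite mulrC mulrA mulrC ler_wpM2l ?(ltW e10)// /C.
    rewrite mulrC ler_wpDr// ler_wpM2l// lerD2r; exact: le_vmax.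
  by rewrite -ler_pdivlMr// ge_min lexx orbT.
rewrite (_ : _ - _ = (potential th - potential (grid n J)) -
  (\sum_(j < J) weight (grid n j) * (compensated (grid n j.+1) - compensated (grid n j)) -
    (potential (grid n J) - potential 0))); last by ring.
apply: le_trans (ler_normB _ _) _.
by rewrite [leRHS](splitr e) lerD// ltW.
Unshelve. all: by end_near. Qed.

End pathwise.

(** * Measurability *)

Section measurable_paths.
Context {R : realType}.

Lemma measurable_le_cst d (T : measurableType d) (g : T -> R) c :
  measurable_fun [set: T] g -> measurable [set w | g w <= c].
Proof.
move=> mg; rewrite (_ : [set w | g w <= c] = [set: T] `&` g @^-1` `]-oo, c]).
  by apply: mg.
by rewrite setTI; apply/seteqP; split=> w /=; rewrite in_itv.
Qed.

Lemma measurable_lt_cst d (T : measurableType d) (g : T -> R) c :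
  measurable_fun [set: T] g -> measurable [set w | g w < c].
Proof.
move=> mg; rewrite (_ : [set w | g w < c] = [set: T] `&` g @^-1` `]-oo, c[).
  by apply: mg.
by rewrite setTI; apply/seteqP; split=> w /=; rewrite in_itv.
Qed.

(** The clamped rationals form a countable dense subset of [[a, b]], even when [a = b]. Only times
    in [[a, b]] are sampled, so adaptedness is preserved. *)
Lemma dense_le (g : R -> R) (a b c : R) : a <= b -> continuous g ->
  (forall q : rat, g (Num.max a (Num.min b (ratr q))) <= c) ->
  forall r, a <= r <= b -> g r <= c.
Proof.
move=> ab cg H r /andP[ar rb]; rewrite leNgt; apply/negP => cr.
have := @cg r => /cvgrPdist_lt/(_ (g r - c)); rewrite subr_gt0 => /(_ cr).
move=> /nbhs_ballP[d /= d0 Hd].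
have /rat_in_itvoo[q] : r < r + d by rewrite ltrDl.
rewrite in_itv/= => /andP[rq qrd].
have := H q; rewrite leNgt => /negP; apply.
have : ball r d (Num.max a (Num.min b (ratr q))).
  have rb' : r <= Num.min b (ratr q) by rewrite le_min rb ltW.
  rewrite (max_r (le_trans ar rb')) /ball /= ler0_norm ?subr_le0//.
  rewrite opprB ltrBlDl gt_min qrd orbT//.
move=> /Hd /=; rewrite ltr_norml => /andP[]; lra.
Qed.

Lemma measurable_forall_le d (T : measurableType d) (g : T -> R -> R) a b c :
  a <= b -> (forall w, continuous (g w)) ->
  (forall r, a <= r <= b -> measurable_fun [set: T] (g ^~ r)) ->
  measurable [set w | forall r, a <= r <= b -> g w r <= c].
Proof.
move=> ab cg mg.
have clamp (q : rat) : a <= Num.max a (Num.min b (ratr q)) <= b.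
  by rewrite le_max lexx/= ge_max ab/= ge_min lexx.
rewrite (_ : [set w | _] = ~` \bigcup_(q : rat)
    ~` [set w | g w (Num.max a (Num.min b (ratr q))) <= c]).
  apply: measurableC; apply: bigcupT_measurable_rat => q.
  by apply/measurableC/measurable_le_cst/mg.
rewrite setC_bigcup; apply/seteqP; split => w /=.
  by move=> H q _; rewrite setCK; apply: H.
move=> H; apply: dense_le => // q; have := H q I; rewrite setCK; exact.
Qed.

Lemma natSinv_lt (x : R) : 0 < x -> exists n : nat, n.+1%:R^-1 < x.
Proof.
by move=> x0; have [n _ H] := near_infty_natSinv_lt (PosNum x0); exists n; apply: H => /=.
Qed.

Lemma forall_lt_uniform (g : R -> R) (a b c : R) : a <= b -> continuous g ->
  (forall r, a <= r <= b -> g r < c) ->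
  exists n : nat, forall r, a <= r <= b -> g r <= c - n.+1%:R^-1.
Proof.
move=> ab cg H; have [|m mab Hm] := @EVT_max _ g a b ab.
  exact: continuous_subspaceT.
have /natSinv_lt[n nc] : 0 < c - g m by rewrite subr_gt0 H//; move: mab; rewrite in_itv.
exists n => r rab; have rab' : r \in `[a, b] by rewrite in_itv.
have := Hm r rab'; move: (n.+1%:R^-1) nc => e; lra.
Qed.

Lemma measurable_forall_lt d (T : measurableType d) (g : T -> R -> R) a b c :
  a <= b -> (forall w, continuous (g w)) ->
  (forall r, a <= r <= b -> measurable_fun [set: T] (g ^~ r)) ->
  measurable [set w | forall r, a <= r <= b -> g w r < c].
Proof.
move=> ab cg mg.
rewrite (_ : [set w | _] = \bigcup_n
    [set w | forall r, a <= r <= b -> g w r <= c - n.+1%:R^-1]).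
  by apply: bigcupT_measurable => n; exact: measurable_forall_le.
apply/seteqP; split => w /=.
  by move=> /(forall_lt_uniform ab (cg w))[n Hn]; exists n.
move=> [n _ Hn] r /Hn /le_lt_trans; apply.
by rewrite ltrBlDr ltrDl invr_gt0.
Qed.

(** With [I] the interval [[0, t]], the sigma-algebra of this type is [natural_filtration t];
    adaptedness becomes ordinary measurability on [paths I]. *)
Definition paths (I : set R) := g_sigma_algebraType (@coordinate_events R I).

Lemma measurable_cpath_fun (I : set R) r : I r ->
  measurable_fun [set: paths I] (fun w : paths I => cpath_fun w r).
Proof.
move=> Ir _ B mB; rewrite setTI; apply: sub_sigma_algebra.
by exists r, B.
Qed.

Section horizon.
Variables (I : set R) (t : R).
Hypotheses (t0 : 0 <= t) (It : forall r, 0 <= r <= t -> I r).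

Let X (w : paths I) := cpath_fun w.

Let cX w : continuous (X w). Proof. exact: cpath_continuous. Qed.

Lemma measurable_runmax : measurable_fun [set: paths I] (fun w => runmax (X w) t).
Proof.
apply: (measurability (@RGenCInfty.G R)) => [|/= _ [_] [r] -> <-].
  exact: RGenCInfty.measurableE.
rewrite setTI (_ : _ @^-1` _ = ~` [set w | forall q, 0 <= q <= t -> X w q < r]).
  apply/measurableC/measurable_forall_lt => // q /It.
  exact: measurable_cpath_fun.
apply/seteqP; split => w /=; rewrite in_itv/= andbT.
  have [q [qt -> _]] := runmax_attained (@cX w) t0.
  by move=> rq H; have := H q qt; rewrite ltNge rq.
move=> H; rewrite leNgt; apply/negP => Sr; apply: H => q qt.
by apply: le_lt_trans Sr; apply: runmax_ge.
Qed.

End horizon.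

Lemma measurable_alive_weight (I : set R) (mu u v beta t : R) :
  0 < u -> 0 <= t -> (forall r, 0 <= r <= t -> I r) ->
  measurable_fun [set: paths I]
    (fun w : paths I => alive_weight mu u v beta (cpath_fun w) t).
Proof.
move=> u0 t0 It.
have malive : measurable [set w : paths I | alive u v beta (cpath_fun w) t].
  apply: measurable_forall_lt => //.
    by move=> w; apply: continuous_deadline; exact: cpath_continuous.
  move=> r /andP[r0 rt].
  have mS : measurable_fun [set: paths I] (fun w => runmax (cpath_fun w) r).
    by apply: measurable_runmax => // q /andP[q0 qr]; apply: It; rewrite q0 (le_trans qr).
  have mX : measurable_fun [set: paths I] (fun w : paths I => cpath_fun w r).
    by apply: measurable_cpath_fun; apply: It; rewrite r0.
  apply: measurable_maxr; first by apply: measurable_funB.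
  apply: measurable_minr; first by apply: measurable_funB.
  by apply: measurable_funB => //; apply: measurable_funB.
rewrite /alive_weight; apply: (measurable_fun_ifT
  (f := fun w : paths I => `[< alive u v beta (cpath_fun w) t >])) => //.
  apply: (measurable_fun_bool true); rewrite setTI.
  rewrite (_ : _ @^-1` _ = [set w : paths I | alive u v beta (cpath_fun w) t])//.
  by apply/seteqP; split=> w /= /asboolP.
apply: measurable_funB => //.
apply: (measurableT_comp (f := wgt mu u)).
  by apply: continuous_measurable_fun; exact: continuous_wgt.
by apply: measurable_maxr => //; exact: measurable_runmax.
Qed.

(** If the path avoids [b] up to [t] then, by continuity, it does so slightly longer, which makes
    the inequality strict. The condition has the shape required by [measurable_forall_lt]. *)
Lemma hitting_time_gt (b t : R) (w : path_space R) : 0 <= t ->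
  (forall r, 0 <= r <= t -> - `|coordinate r w - b| < 0) <->
  (t%:E < hitting_time b w)%E.
Proof.
move=> t0; split=> [H|H r /andP[r0 rt]]; last first.
  rewrite oppr_lt0 normr_gt0 subr_eq0; apply/eqP => Xr.
  move: H; rewrite ltNge => /negP; apply.
  apply: (@le_trans _ _ r%:E); last by rewrite lee_fin.
  by apply: ereal_inf_lbound; exists r.
have cX := @cpath_continuous _ w.
have cg : continuous (fun r => - `|coordinate r w - b|).
  move=> x; apply: cvgN; apply: cvg_norm.
  by apply: cvgB; [exact: cX|exact: cvg_cst].
have := @cg t => /cvgrPdist_lt/(_ (`|coordinate t w - b|)).
have tt : 0 <= t <= t by rewrite t0 lexx.
have := H t tt; rewrite oppr_lt0 => Ht /(_ Ht) /nbhs_ballP[d /= d0 Hd].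
apply: (@lt_le_trans _ _ (t + d / 2)%:E); first by rewrite lte_fin ltrDl divr_gt0.
apply: le_ereal_inf_tmp => _ [r [r0 Xr] <-]; rewrite lee_fin leNgt; apply/negP => rd.
have [rt|tr] := leP r t.
  by have := H r; rewrite r0 rt Xr subrr normr0 oppr0 ltxx => /(_ isT).
have /Hd /= : ball t d r by rewrite /ball /= ler0_norm ?subr_le0 ?ltW//; lra.
by rewrite Xr subrr normr0 oppr0 subr0 normrN normr_id ltxx.
Qed.

(** A countable description of the event: the strict bound on a supremum becomes a margin
    [1 / (n + 1)], and every end time, including the hitting time itself, is approached from the
    left by rationals. *)
Lemma max_decrease_ltP (b u : R) (w : path_space R) : 0 < u ->
  (max_decrease (hitting_time b w) w < u%:E)%E <->
  exists n : nat, forall q : rat, (((Num.max 0 (ratr q) : R))%:E < hitting_time b w)%E ->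
    forall s, 0 <= s <= Num.max 0 (ratr q) ->
    coordinate s w - coordinate (Num.max 0 (ratr q)) w <= u - n.+1%:R^-1.
Proof.
move=> u0; have cX := @cpath_continuous _ w; split=> [Du|[n Hn]].
  have : exists n : nat, (max_decrease (hitting_time b w) w <= (u - n.+1%:R^-1)%:E)%E.
    case: (max_decrease _ _) Du => [d|//|_]; last by exists 0%N; rewrite leNye.
    rewrite lte_fin -subr_gt0 => /natSinv_lt[n nd]; exists n; rewrite lee_fin.
    by move: (n.+1%:R^-1) nd => e; lra.
  move=> [n Dn]; exists n => q qH s /andP[s0 sq].
  rewrite -lee_fin; apply: le_trans Dn; apply: ereal_sup_ubound.
  by exists s, (Num.max 0 (ratr q)); split => //; exact: ltW.
(* The [0] covers the pairs [s = t], which leave no room for a rational time between them. *)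
apply: (@le_lt_trans _ _ (Num.max 0 (u - n.+1%:R^-1))%:E); last first.
  by rewrite lte_fin gt_max u0/= gtrBl invr_gt0.
apply: ge_ereal_sup => _ [s [t [s0 st tH ->]]]; rewrite lee_fin.
have [->|sNt] := eqVneq s t; first by rewrite subrr le_max lexx.
have {sNt}st : s < t by rewrite lt_neqAle sNt.
rewrite le_max; apply/orP; right; rewrite leNgt; apply/negP.
move: (u - _) Hn => c Hn ct.
have t0 := le_lt_trans s0 st.
have := @cX t => /cvgrPdist_lt/(_ (coordinate s w - coordinate t w - c)).
rewrite subr_gt0 => /(_ ct) /nbhs_ballP[d /= d0 Hd].
have /rat_in_itvoo[q] : Num.max s (t - d) < t by rewrite gt_max st gtrBl.
rewrite in_itv/= gt_max => /andP[/andP[sq tdq] qt].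
have q0 : 0 <= ratr q :> R by apply: ltW; exact: le_lt_trans sq.
have qE : Num.max 0 (ratr q) = ratr q :> R by exact: max_r.
have qH : ((Num.max 0 (ratr q) : R)%:E < hitting_time b w)%E.
  by apply: lt_le_trans tH; rewrite qE lte_fin.
have := Hn q qH s; rewrite qE s0 (ltW sq) => /(_ isT) Hs.
have /Hd : ball t d (ratr q).
  rewrite /ball /= ger0_norm ?subr_ge0 ?(ltW qt)//; lra.
move: Hs ct; rewrite /coordinate => Hs ct; rewrite ltr_norml => /andP[]; lra.
Qed.

Lemma measurable_max_decrease_lt (b u : R) : 0 < u ->
  measurable [set w : path_space R | (max_decrease (hitting_time b w) w < u%:E)%E].
Proof.
move=> u0.
pose p (q : rat) : R := Num.max 0 (ratr q).
have p0 q : 0 <= p q by rewrite le_max lexx.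
have mX r : 0 <= r -> measurable_fun [set: path_space R] (coordinate r : path_space R -> R).
  by move=> r0; exact: measurable_cpath_fun.
have cX (w : path_space R) : continuous (cpath_fun w) by exact: cpath_continuous.
have mH q : measurable [set w : path_space R | ((p q)%:E < hitting_time b w)%E].
  rewrite (_ : [set w | _] = [set w : path_space R | forall r, 0 <= r <= p q ->
      - `|coordinate r w - b| < 0]).
    apply: measurable_forall_lt => //.
      move=> w x; apply: cvgN; apply: cvg_norm.
      by apply: cvgB; [exact: cX|exact: cvg_cst].
    move=> r /andP[r0 _]; apply: measurable_funN.
    apply: (measurableT_comp (f := @Num.Def.normr R R)) => //.
    by apply: measurable_funB => //; exact: mX.
  by apply/seteqP; split=> w /=; rewrite hitting_time_gt.
rewrite (_ : [set w | _] = \bigcup_n ~` \bigcup_(q : rat)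
   ([set w : path_space R | ((p q)%:E < hitting_time b w)%E] `&`
    ~` [set w : path_space R | forall s, 0 <= s <= p q ->
       coordinate s w - coordinate (p q) w <= u - n.+1%:R^-1])).
  apply: bigcupT_measurable => n; apply: measurableC.
  apply: bigcupT_measurable_rat => q; apply: measurableI; first exact: mH.
  apply: measurableC; apply: measurable_forall_le => //.
    by move=> w x; apply: cvgB; [exact: cX|exact: cvg_cst].
  by move=> r /andP[r0 _]; apply: measurable_funB; exact: mX.
apply/seteqP; split => w /=.
  move=> /(max_decrease_ltP b w u0)[n Hn]; exists n => //= -[q _ [/= qH]]; apply.
  exact: Hn.
move=> [n _ Hn]; apply/(max_decrease_ltP b w u0); exists n => q qH.
by apply: contrapT => nH; apply: Hn; exists q.
Qed.

End measurable_paths.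

(** * Expectations and martingale increments *)

Section bounded_expectation.
Context {R : realType} d (T : measurableType d) (P : probability T R).
Implicit Types f g xi D : T -> R.

Definition bounded_mfun g :=
  measurable_fun [set: T] g /\ exists K, forall w, `|g w| <= K.

Lemma bounded_mfun_integrable g : bounded_mfun g ->
  P.-integrable [set: T] (EFin \o g).
Proof.
move=> [mg [K gK]]; apply: measurable_bounded_integrable => //.
  exact: fin_num_fun_lty.
exists K; split; first exact: num_real.
by move=> x Kx w _; apply: le_trans (gK w) (ltW Kx).
Qed.

Lemma bounded_mfun_cst (c : R) : bounded_mfun (fun=> c).
Proof. by split => //; exists `|c|. Qed.

Lemma bounded_mfunD f g : bounded_mfun f -> bounded_mfun g ->
  bounded_mfun (fun w => f w + g w).
Proof.
move=> [mf [K fK]] [mg [L gL]]; split; first exact: measurable_funD.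
by exists (K + L) => w; apply: le_trans (ler_normD _ _) _; exact: lerD.
Qed.

Lemma bounded_mfunM f g : bounded_mfun f -> bounded_mfun g ->
  bounded_mfun (fun w => f w * g w).
Proof.
move=> [mf [K fK]] [mg [L gL]]; split; first exact: measurable_funM.
by exists (K * L) => w; rewrite normrM; exact: ler_pM.
Qed.

Lemma bounded_mfunB f g : bounded_mfun f -> bounded_mfun g ->
  bounded_mfun (fun w => f w - g w).
Proof.
move=> [mf [K fK]] [mg [L gL]]; split; first exact: measurable_funB.
by exists (K + L) => w; apply: le_trans (ler_normB _ _) _; exact: lerD.
Qed.

Lemma bounded_mfun_indic (A : set T) : measurable A -> bounded_mfun (\1_A : T -> R).
Proof.
move=> mA; split; first exact: measurable_indic.
by exists 1 => w; rewrite indicE; case: (w \in A); rewrite ?normr1 ?normr0.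
Qed.

Lemma bounded_mfun_sum (n : nat) (F : nat -> T -> R) :
  (forall j, bounded_mfun (F j)) -> bounded_mfun (fun w => \sum_(j < n) F j w).
Proof.
move=> bF; elim: n => [|n IH].
  under eq_fun do rewrite big_ord0; exact: bounded_mfun_cst.
by under eq_fun do rewrite big_ord_recr/=; exact: bounded_mfunD.
Qed.

Lemma expectationD f g : bounded_mfun f -> bounded_mfun g ->
  \int[P]_w (f w + g w) = \int[P]_w f w + \int[P]_w g w.
Proof. by move=> bf bg; rewrite RintegralD//; exact: bounded_mfun_integrable. Qed.

Lemma expectationB f g : bounded_mfun f -> bounded_mfun g ->
  \int[P]_w (f w - g w) = \int[P]_w f w - \int[P]_w g w.
Proof. by move=> bf bg; rewrite RintegralB//; exact: bounded_mfun_integrable. Qed.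

Lemma expectationZ (c : R) f : bounded_mfun f ->
  \int[P]_w (c * f w) = c * \int[P]_w f w.
Proof. by move=> bf; rewrite RintegralZl//; exact: bounded_mfun_integrable. Qed.

Lemma expectation_cst (c : R) : \int[P]_w c = c.
Proof.
rewrite Rintegral_cst// -[RHS]mulr1; congr (_ * _).
exact: (congr1 fine (@probability_setT _ _ _ P)).
Qed.

Lemma expectation_indic (A : set T) : measurable A -> (\int[P]_w (\1_A w) = fine (P A))%R.
Proof. by move=> mA; rewrite /Rintegral integral_indic// setIT. Qed.

Lemma le_expectation f g : bounded_mfun f -> bounded_mfun g -> (forall w, f w <= g w) ->
  \int[P]_w f w <= \int[P]_w g w.
Proof. by move=> bf bg fg; apply: le_Rintegral => //; exact: bounded_mfun_integrable. Qed.

Lemma expectation_sum (n : nat) (F : nat -> T -> R) :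
  (forall j, bounded_mfun (F j)) ->
  \int[P]_w (\sum_(j < n) F j w) = \sum_(j < n) \int[P]_w F j w.
Proof.
move=> bF; elim: n => [|n IH].
  rewrite big_ord0 -[RHS](expectation_cst 0); apply: eq_Rintegral => w _.
  by rewrite big_ord0.
rewrite big_ord_recr/= -IH -expectationD//; last exact: bounded_mfun_sum.
by apply: eq_Rintegral => w _; rewrite big_ord_recr.
Qed.

Lemma expectation_norm_le f (K : R) : bounded_mfun f -> (forall w, `|f w| <= K) ->
  `|\int[P]_w f w| <= K.
Proof.
move=> bf fK; have bc := bounded_mfun_cst.
rewrite ler_norml -[X in X <= _]expectation_cst -[X in _ && (_ <= X)]expectation_cst.
by apply/andP; split; apply: le_expectation => // w; have := fK w; rewrite ler_norml => /andP[].
Qed.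

(** [xi] is uniformly within [1 / (n + 1)] of a step function on its level sets, and the step
    function integrates to zero against [D]. This passes from the martingale property on events to
    bounded adapted weights. *)
Lemma orthogonal_level_sets xi D :
  bounded_mfun xi -> (forall w, 0 <= xi w) -> bounded_mfun D ->
  (forall a b, \int[P]_w (\1_[set w | a <= xi w < b] w * D w) = 0) ->
  \int[P]_w (xi w * D w) = 0.
Proof.
move=> bxi xi0 bD orth; have [mxi [A xiA]] := bxi; have [_ [K DK]] := bD.
have [[w0 _]|noT] := pselect (exists w : T, True); last first.
  by rewrite -[RHS](expectation_cst 0); apply: eq_Rintegral => w; case: noT; exists w.
have K0 : 0 <= K by apply: le_trans (DK w0).
have key (n : nat) : `|\int[P]_w (xi w * D w)| <= n.+1%:R^-1 * K.
  (* Enough levels of height [1 / (n + 1)] to cover the range of [xi], which is bounded by [A]. *)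
  pose m := Num.bound (A * n.+1%:R).
  pose c (k : nat) : R := k%:R / n.+1%:R.
  pose L k := [set w | c k <= xi w < c k.+1].
  have mL k : measurable (L k).
    rewrite (_ : L k = ~` [set w | xi w < c k] `&` [set w | xi w < c k.+1]).
      by apply: measurableI; [apply: measurableC|]; exact: measurable_lt_cst.
    apply/seteqP; split=> w /=.
      by move=> /andP[ckx ->]; split=> //; rewrite ltNge ckx.
    by move=> [/negP h1 h2]; rewrite /L /= h2 leNgt h1.
  pose S w := \sum_(k < m) c k * \1_(L k) w.
  have bL k : bounded_mfun (fun w => c k * \1_(L k) w).
    by apply: bounded_mfunM; [exact: bounded_mfun_cst|exact: bounded_mfun_indic].
  have bS : bounded_mfun S by exact: (@bounded_mfun_sum m (fun k w => c k * \1_(L k) w)).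
  have SE w : `|xi w - S w| <= n.+1%:R^-1.
    have n0 : 0 < n.+1%:R :> R by [].
    have x0 : 0 <= xi w * n.+1%:R by rewrite mulr_ge0.
    have /andP[k1 k2] := truncn_itv x0.
    set k0 := Num.truncn _ in k1 k2.
    have k0m : (k0 < m)%N.
      rewrite -(ltr_nat R); apply: le_lt_trans k1 _.
      apply: le_lt_trans (archi_boundP _).
        by rewrite ler_wpM2r//; apply: le_trans (xiA w); exact: ler_norm.
      rewrite mulr_ge0//; exact: le_trans (xiA w).
    have Lk0 : L k0 w.
      by rewrite /L /c /= ler_pdivrMr// ltr_pdivlMr// k1.
    have -> : S w = c k0.
      rewrite /S (bigD1 (Ordinal k0m))//= indicE mem_set// mulr1 big1 ?addr0// => k kk0.
      rewrite indicE memNset ?mulr0//= => /andP[].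
      rewrite /c ler_pdivrMr// ltr_pdivlMr// => h1 h2.
      have i1 : (k < k0.+1)%N by rewrite -(ltr_nat R); exact: le_lt_trans h1 k2.
      have i2 : (k0 < k.+1)%N by rewrite -(ltr_nat R); exact: le_lt_trans k1 h2.
      move/negP: kk0; apply; apply/eqP/val_inj => /=; apply/eqP.
      by rewrite eqn_leq -ltnS i1 -ltnS.
    have cS : c k0.+1 = c k0 + n.+1%:R^-1 by rewrite /c -[in LHS]natr1 mulrDl mul1r.
    move: Lk0 => /andP[h1]; rewrite cS => h2.
    by rewrite ger0_norm ?subr_ge0// lerBlDl ltW.
  have -> : \int[P]_w (xi w * D w) = \int[P]_w ((xi w - S w) * D w).
    have -> : \int[P]_w ((xi w - S w) * D w) = \int[P]_w (xi w * D w - S w * D w).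
      by apply: eq_Rintegral => w _; rewrite mulrBl.
    rewrite expectationB; [|exact: bounded_mfunM|exact: bounded_mfunM].
    suff -> : \int[P]_w (S w * D w) = 0 by rewrite subr0.
    have -> : \int[P]_w (S w * D w) = \int[P]_w (\sum_(k < m) c k * (\1_(L k) w * D w)).
      by apply: eq_Rintegral => w _; rewrite mulr_suml; apply: eq_bigr => k _; rewrite mulrA.
    have bLD k : bounded_mfun (fun w => \1_(L k) w * D w).
      by apply: bounded_mfunM => //; exact: bounded_mfun_indic.
    rewrite (@expectation_sum m (fun k w => c k * (\1_(L k) w * D w))); last first.
      by move=> k; apply: bounded_mfunM => //; exact: bounded_mfun_cst.
    by rewrite big1// => k _; rewrite expectationZ// orth mulr0.
  apply: expectation_norm_le; first by apply: bounded_mfunM => //; exact: bounded_mfunB.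
  by move=> w; rewrite normrM; exact: ler_pM.
apply/eqP; rewrite -normr_le0 leNgt; apply/negP => I0.
have : 0 < `|\int[P]_w (xi w * D w)| / (K + 1) by rewrite divr_gt0// ltr_wpDl.
move=> /natSinv_lt[n]; rewrite ltr_pdivlMr ?ltr_wpDl//.
rewrite ltNge => /negP; apply; apply: le_trans (key n) _.
by rewrite ler_wpM2l// lerDl.
Qed.

Lemma martingale_orthogonal (F : R -> set (set T)) (M : R -> T -> R) (s t : R) xi :
  martingale P F M -> 0 <= s -> s <= t ->
  (forall a b, F s [set w | a <= xi w < b]) -> (forall A, F s A -> measurable A) ->
  bounded_mfun xi -> (forall w, 0 <= xi w) ->
  bounded_mfun (M s) -> bounded_mfun (M t) ->
  \int[P]_w (xi w * (M t w - M s w)) = 0.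
Proof.
move=> [_ _ mart] s0 st Fxi Fm bxi xi0 bMs bMt.
apply: orthogonal_level_sets => //; first exact: bounded_mfunB.
move=> a b; set A := [set w | _]; have FA : F s A by exact: Fxi.
have bA : bounded_mfun (\1_A : T -> R) by apply: bounded_mfun_indic; exact: Fm.
have -> : \int[P]_w (\1_A w * (M t w - M s w)) =
    \int[P]_w (\1_A w * M t w - \1_A w * M s w).
  by apply: eq_Rintegral => w _; rewrite mulrBr.
rewrite expectationB; [|exact: bounded_mfunM|exact: bounded_mfunM].
have H r : \int[P]_w (\1_A w * M r w) = \int[P]_(w in A) M r w.
  rewrite [in RHS]Rintegral_mkcond; apply: eq_Rintegral => w _.
  by rewrite patchE indicE; case: (w \in A); rewrite ?mul1r ?mul0r.
by rewrite !H /Rintegral (mart s t s0 st A FA) subrr.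
Qed.

Lemma bounded_convergence (f_ : nat -> T -> R) f (K : R) :
  (forall n, measurable_fun [set: T] (f_ n)) -> measurable_fun [set: T] f ->
  (\forall w \ae P, f_ n w @[n --> \oo] --> f w) ->
  (\forall w \ae P, forall n, `|f_ n w| <= K) ->
  \int[P]_w f_ n w @[n --> \oo] --> \int[P]_w f w.
Proof.
move=> mf_ mf cv bd.
have [|||||i1 i2 i3] := @dominated_convergence _ _ _ P [set: T] measurableT
    (fun n w => (f_ n w)%:E) (fun w => (f w)%:E) (fun=> K%:E).
- by move=> n; exact/measurable_EFinP.
- exact/measurable_EFinP.
- by apply: filterS cv => w cw _; apply: cvg_EFin => //; exact: nearW.
- exact: (bounded_mfun_integrable (bounded_mfun_cst K)).
- by apply: filterS bd => w bw n _; rewrite lee_fin.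
apply: fine_cvg; rewrite /= fineK//.
exact: integrable_fin_num.
Qed.

End bounded_expectation.

(** * The stopped potential *)

Section stopped_path.
Context {R : realType}.
Variables (u v beta T : R) (X : R -> R).
Hypothesis cX : continuous X.
Hypothesis T0 : 0 <= T.

Let th := stopping u v beta X T.

Lemma left_limit_le (g : R -> R) (a b c : R) : continuous g -> a < b ->
  (forall r, a <= r < b -> g r <= c) -> g b <= c.
Proof.
move=> cg ab H; rewrite leNgt; apply/negP => cb.
have := @cg b => /cvgrPdist_lt/(_ (g b - c)); rewrite subr_gt0 => /(_ cb).
move=> /nbhs_ballP[d /= d0 Hd].
pose r := Num.max a (b - d / 2).
have rb : r < b by rewrite gt_max ab gtrBl divr_gt0.
have ar : a <= r by rewrite le_max lexx.
have := H r; rewrite ar rb => /(_ isT) gr.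
have /Hd /= : ball b d r.
  rewrite /ball /= ger0_norm ?subr_ge0 ?(ltW rb)//.
  have : b - d / 2 <= r by rewrite le_max lexx orbT.
  by move: d0; lra.
rewrite ltr_norml => /andP[]; lra.
Qed.

Lemma runmax_stopping_le : X 0 <= beta -> runmax X th <= beta.
Proof.
move=> X0; have /andP[th0 thT] := stopping_itv u v beta X T0.
have [E|th_neq0] := eqVneq th 0; first by rewrite E (runmax0 cX).
have th_gt0 : 0 < th by rewrite lt_neqAle eq_sym th_neq0.
apply: (left_limit_le (continuous_runmax cX) th_gt0) => r /andP[r0 rth].
have := lt_stopping_alive T0 rth => /(_ r); rewrite r0 lexx deadline_lt0 => /(_ isT).
by move=> /andP[/ltW].
Qed.

(** From the time [q] where the maximum is attained until [th], the running maximum is constant and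
    at least [v], so being alive bounds the drop by [u]; the bound passes to the left limit. If
    [q = th] the drop is zero. *)
Lemma drop_stopping_le : 0 <= u -> v <= runmax X th -> runmax X th - X th <= u.
Proof.
move=> u0 vS; have /andP[th0 thT] := stopping_itv u v beta X T0.
have [q [/andP[q0 qth] SE Hq]] := runmax_attained cX th0.
have [E|q_neq] := eqVneq q th; first by rewrite SE E subrr.
have qlt : q < th by rewrite lt_neqAle q_neq.
have cg : continuous (fun r => runmax X th - X r).
  by move=> x; apply: cvgB; [exact: cvg_cst|exact: cX].
apply: (left_limit_le cg qlt) => r /andP[qr rth].
have Sr : runmax X r = runmax X th.
  apply/eqP; rewrite eq_le (le_runmax cX (ltW rth))/= SE.
  by apply: runmax_ge => //; rewrite q0 qr.
have r0 : 0 <= r by exact: le_trans q0 qr.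
have := lt_stopping_alive T0 rth => /(_ r); rewrite r0 lexx deadline_lt0 Sr => /(_ isT).
by rewrite (ltNge _ v) vS/= => /andP[_ /ltW].
Qed.

Lemma stoppingE H : 0 <= H -> H < T -> (forall r, 0 <= r < H -> deadline u v beta X r < 0) ->
  0 <= deadline u v beta X H -> th = H.
Proof.
move=> H0 HT Hal Hdead; apply/eqP; rewrite eq_le; apply/andP; split.
  rewrite leNgt; apply/negP => /(lt_stopping_alive T0)/(_ H).
  by rewrite H0 lexx ltNge Hdead => /(_ isT).
rewrite leNgt; apply/negP => thH.
have /andP[th0 _] := stopping_itv u v beta X T0.
pose m := (th + H) / 2.
have thm : th < m by rewrite /m; lra.
have mH : m < H by rewrite /m; lra.
have m0 : 0 <= m by apply: le_trans th0 (ltW thm).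
have al : alive u v beta X m.
  by move=> r /andP[r0 rm]; apply: Hal; rewrite r0 (le_lt_trans rm).
have mT : 0 <= m <= T by rewrite m0 (ltW (lt_trans mH HT)).
by have := alive_le_stopping mT al; rewrite -/th leNgt thm.
Qed.

Lemma stopping_le r : 0 <= r -> 0 <= deadline u v beta X r -> th <= r.
Proof.
move=> r0 dr; rewrite leNgt; apply/negP => /(lt_stopping_alive T0)/(_ r).
by rewrite r0 lexx ltNge dr => /(_ isT).
Qed.

End stopped_path.

(** * The first passage at the level [beta] *)

Section first_hitting.
Context {R : realType}.
Variables (beta : R) (X : R -> R).
Hypothesis cX : continuous X.

Lemma first_hitting_exists t1 : X 0 < beta -> 0 <= t1 -> X t1 = beta ->
  exists H, [/\ 0 < H, X H = beta, runmax X H = beta &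
     forall r, r < H -> runmax X r < beta].
Proof.
move=> X0 t10 Xt1.
have T0 : 0 <= t1 + 1 by rewrite addr_ge0.
(* With [u = 0] and [v = beta], [deadline] is negative exactly when the running maximum is below
   [beta]. The horizon [t1 + 1] keeps [H] strictly below the cap. *)
pose H := stopping 0 beta beta X (t1 + 1).
have /andP[H0 HT] := stopping_itv 0 beta beta X T0; rewrite -/H in H0 HT.
have S1 : beta <= runmax X t1 by rewrite -Xt1 runmax_ge// t10 lexx.
have Ht1 : H <= t1.
  by apply: stopping_le => //; rewrite leNgt deadline_lt0 ltNge S1.
have : 0 <= deadline 0 beta beta X H by apply: stopping_dead => //; rewrite -/H; lra.
have SH : runmax X H <= beta by apply: runmax_stopping_le => //; exact: ltW.
have Sr r : r < H -> runmax X r < beta.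
  have [r0|r0] := leP 0 r; last by move=> _; rewrite (runmax0 cX (ltW r0)).
  move=> /(lt_stopping_alive T0)/(_ r); rewrite r0 lexx deadline_lt0 => /(_ isT).
  by case/andP.
rewrite leNgt deadline_lt0 negb_and negb_or.
have [SHb _|SHb /=] := leP beta (runmax X H); last by [].
have SE : runmax X H = beta by apply/eqP; rewrite eq_le SH.
have [q [/andP[q0 qH] Sq _]] := runmax_attained cX H0.
have XH : X H = beta.
  move: qH; rewrite le_eqVlt => /predU1P[<-|/Sr]; first by rewrite -Sq SE.
  have Xq : X q <= runmax X q by rewrite runmax_ge// q0 lexx.
  by rewrite ltNge -[in X in ~~ X]SE Sq Xq.
exists H; split => //.
rewrite lt_neqAle H0 andbT; apply/eqP => E.
by move: X0; rewrite E XH ltxx.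
Qed.

End first_hitting.

(** * A bound on the stopped potential uniform in [v] and in the horizon *)

Section stopped_potential.
Context {R : realType}.
Variables (mu u v beta : R) (f : R -> R) (X : R -> R).
Hypothesis cX : continuous X.
Hypotheses (u0 : 0 < u) (uv : u < v) (vbeta : v < beta).
Hypothesis fE : forall x, (v - u) / 2 <= x <= beta + 1 -> f x = hscale mu x.
Hypothesis X0 : X 0 <= v.

Lemma potential0 : potential mu u v f X 0 = off mu u v.
Proof.
by rewrite /potential /weight /vmax (runmax0 cX (lexx 0)) (max_l X0) subrr mul0r add0r.
Qed.

Lemma wgt_ge0 m : u <= m -> 0 <= wgt mu u m.
Proof.
move=> um; have := ler_wgt mu u0 (ltW u0) um.
by rewrite {1}/wgt subrr hsin0 mulr0 mul0r.
Qed.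

Lemma off_ge0 m : 0 <= off mu u m.
Proof.
by rewrite divr_ge0 ?(ltW (hsin_gt0 _ u0))// mulr_ge0 ?expR_ge0// ltW// hcos_gt0.
Qed.

(** If the maximum [m] exceeds [v], then [x >= m - u] at the stopping time, so
    [wgt m * hscale x + off m >= 0]. As [hscale x <= 0] and [0 <= wgt v <= wgt m], the potential
    lies between [0] and [off m]. *)
Lemma potential_stopping_bound (T : R) : 0 <= T ->
  `|potential mu u v f X (stopping u v beta X T)| <= 2 * off mu u beta.
Proof.
move=> T0; set th := stopping _ _ _ _ _.
have /andP[th0 _] := stopping_itv u v beta X T0; rewrite -/th in th0.
have Sb : runmax X th <= beta.
  by apply: runmax_stopping_le => //; exact: le_trans X0 (ltW vbeta).
have offb := off_ge0 beta.
have [Sv|vS] := leP (runmax X th) v.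
  rewrite /potential /weight /vmax (max_l Sv) subrr mul0r add0r ger0_norm ?off_ge0//.
  apply: le_trans (ler_off mu u0 (ltW vbeta)) _; lra.
have dr : runmax X th - X th <= u by apply: drop_stopping_le => //; exact: ltW.
have XS : X th <= runmax X th by rewrite runmax_ge// th0 lexx.
rewrite /potential /weight /vmax (max_r (ltW vS)).
move: vS Sb dr XS; move: (runmax X th) (X th) => m x vm mb mxu xm.
have [huv hu hvb] : [/\ u < v, 0 < u & v < beta] by split.
have x0 : 0 < x by lra.
have sx := hsin_gt0 mu x0; have su := hsin_gt0 mu u0.
rewrite fE; last by apply/andP; split; lra.
have wm : 0 <= wgt mu u m by apply: wgt_ge0; lra.
have wv : 0 <= wgt mu u v by apply: wgt_ge0; lra.
have wvm : wgt mu u v <= wgt mu u m by apply: ler_wgt => //; lra.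
have sc : hscale mu x <= 0 by rewrite oppr_le0 divr_ge0// ?ltW// hcos_gt0.
have : 0 <= wgt mu u m * hscale mu x + off mu u m.
  rewrite (wgt_scale_off u0 m (lt0r_neq0 sx)) divr_ge0 ?mulr_ge0 ?expR_ge0 ?(ltW sx) ?(ltW su)//.
  have : 0 <= x - (m - u) by lra.
  by rewrite le_eqVlt => /predU1P[<-|/(hsin_gt0 mu)/ltW//]; rewrite hsin0.
have : off mu u m <= off mu u beta by exact: ler_off.
have : 0 <= off mu u m by exact: off_ge0.
move: (off mu u m) (off mu u beta) (wgt mu u m) (wgt mu u v) (hscale mu x) offb wm wv wvm sc
  => om ob wm wv s offb wm0 wv0 wvm sc om0 omb H.
rewrite ler_norml; apply/andP; split; nra.
Qed.

End stopped_potential.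

(** * The stopped potential as [v] decreases to [u] and the horizon grows *)

Section potential_limit.
Context {R : realType}.
Variables (mu u beta H : R) (X : R -> R) (v_ : nat -> R) (f_ : nat -> R -> R).
Hypothesis cX : continuous X.
Hypotheses (u0 : 0 < u) (uv : forall i, u < v_ i) (vbeta : forall i, v_ i < beta).
Hypothesis fE : forall i x, (v_ i - u) / 2 <= x <= beta + 1 -> f_ i x = hscale mu x.
Hypothesis cvg_v : v_ i @[i --> \oo] --> u.
Hypotheses (X0 : X 0 = 0) (Xpos : forall t, 0 < t -> 0 < X t).
Hypotheses (H0 : 0 < H) (XH : X H = beta) (SH : runmax X H = beta).
Hypothesis Sr : forall r, r < H -> runmax X r < beta.

Let theta i := stopping u (v_ i) beta X i%:R.

Let cvg_wgt_v : wgt mu u (v_ i) @[i --> \oo] --> (0 : R).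
Proof.
have <- : wgt mu u u = 0 by rewrite /wgt subrr hsin0 mulr0 mul0r.
have cw : {for u, continuous (wgt mu u)} by exact: continuous_wgt.
exact: (cvg_comp v_ (wgt mu u) cvg_v cw).
Qed.

Let near_horizon : \forall i \near \oo, H < i%:R.
Proof. by near=> i; near: i; exact: nbhs_infty_gtr. Unshelve. all: by end_near. Qed.

(** Here [theta i = H] as soon as the horizon [i] exceeds [H], so the stopped value is
    [F(beta, beta) - wgt (v_ i) * hscale beta]. *)
Lemma cvg_potential_no_drop :
  (forall r, 0 <= r <= H -> runmax X r - X r < u) ->
  potential mu u (v_ i) (f_ i) X (theta i) @[i --> \oo]
    --> expR (kappa mu u * beta) / hsin mu beta.
Proof.
move=> nodrop; have b0 : 0 < beta by rewrite -XH Xpos.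
have su := hsin_gt0 mu u0; have sb := hsin_gt0 mu b0.
have lim : (wgt mu u beta - wgt mu u (v_ i)) * hscale mu beta + off mu u beta @[i --> \oo]
    --> expR (kappa mu u * beta) / hsin mu beta.
  have -> : expR (kappa mu u * beta) / hsin mu beta =
      (wgt mu u beta - 0) * hscale mu beta + off mu u beta.
    rewrite subr0 (wgt_scale_off u0 _ (lt0r_neq0 sb)) opprB addrC subrK.
    by field; rewrite !lt0r_neq0.
  apply: cvgD; last exact: cvg_cst.
  apply: cvgM; last exact: cvg_cst.
  by apply: cvgB; [exact: cvg_cst|exact: cvg_wgt_v].
apply: cvg_trans lim; apply: near_eq_cvg; near=> i.
have Hi : H < i%:R by near: i; exact: near_horizon.
have thE : theta i = H.
  apply: stoppingE => //; first exact: ltW.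
    move=> r /andP[r0 rH]; rewrite deadline_lt0 (Sr rH)/=.
    by rewrite nodrop ?orbT// r0 ltW.
  by rewrite leNgt deadline_lt0 SH ltxx.
rewrite /potential /weight /vmax thE SH XH (max_r (ltW (vbeta i))) fE//.
have := uv i; have := vbeta i; move: b0 u0.
by move=> h1 h2 h3 h4; apply/andP; split; lra.
Unshelve. all: by end_near. Qed.

(** Eventually the path is stopped by a drop of exactly [u], where [F] vanishes and
    [- wgt (v_ i) * hscale (X (theta i))] is left. The first factor tends to zero; the second must
    be bounded uniformly in [i]. *)
Lemma cvg_potential_drop r0 : 0 <= r0 <= H -> u <= runmax X r0 - X r0 ->
  potential mu u (v_ i) (f_ i) X (theta i) @[i --> \oo] --> (0 : R).
Proof.
move=> /andP[r00 r0H] drop.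
have r0pos : 0 < r0.
  rewrite lt_neqAle r00 andbT; apply/eqP => E.
  by move: drop; rewrite -E (runmax0 cX)// subrr leNgt u0.
have Su : u < runmax X r0.
  by apply: lt_le_trans (_ : u + X r0 <= _); [rewrite ltrDl Xpos|rewrite -lerBrDr].
(* Each [theta i] concerned is at least [t0], because the maximum is there above [v_ i > u]. On
   [[t0, H]] the path is continuous and positive, so [hscale] is bounded along it. *)
have [t0 t00 St0] : exists2 t0, 0 < t0 & runmax X t0 <= u.
  have := @continuous_runmax _ X cX 0 => /cvgrPdist_lt/(_ _ u0)/nbhs_ballP[d /= d0 Hd].
  exists (d / 2); first by rewrite divr_gt0.
  have /Hd /= : ball 0 d (d / 2).
    by rewrite /ball /= sub0r normrN gtr0_norm ?divr_gt0//; move: d0; lra.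
  by rewrite (runmax0 cX)// X0 sub0r normrN => /ltW; apply: le_trans; exact: ler_norm.
have [B BE] : exists B, forall r, t0 <= r <= H -> `|hscale mu (X r)| <= B.
  have [t0H|Ht0] := leP t0 H; last first.
    by exists 0 => r /andP[h1 h2]; move: (lt_le_trans (le_lt_trans h2 Ht0) h1); rewrite ltxx.
  have [|c _ hc] := @EVT_max _ (fun r => `|hscale mu (X r)|) t0 H t0H.
    apply: continuous_in_subspaceT => r; rewrite inE/= in_itv/= => /andP[t0r _].
    have Xr : 0 < X r by apply: Xpos; exact: lt_le_trans t0r.
    apply: cvg_norm; apply: (@continuous_comp _ _ _ X (hscale mu)); first exact: cX.
    exact: continuous_is_derive (is_derive_hscale mu Xr).
  by exists (`|hscale mu (X c)|) => r rt; apply: hc; rewrite in_itv.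
apply/norm_cvg0P; apply: (@squeeze_cvgr _ _ _ _ (fun=> 0) (fun i => wgt mu u (v_ i) * B)).
- near=> i; rewrite normr_ge0/=.
  have Hi : H < i%:R by near: i; exact: near_horizon.
  (* Positivity of [X r0] makes the maximum at [r0] strictly larger than [u]; hence for large [i]
     the drop at [r0] occurs above the level [v_ i] and does stop the path. *)
  have vS : v_ i < runmax X r0 by near: i; exact: (cvgr_lt _ cvg_v).
  have i0 : 0 <= i%:R :> R by [].
  have dead0 : 0 <= deadline u (v_ i) beta X r0.
    by rewrite leNgt deadline_lt0 negb_and negb_or -!leNgt (ltW vS) drop orbT.
  have th_le : theta i <= r0 by exact: stopping_le.
  have /andP[th0 _] := stopping_itv u (v_ i) beta X i0; rewrite -/(theta i) in th0.
  have : 0 <= deadline u (v_ i) beta X (theta i).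
    apply: stopping_dead => //; rewrite -/(theta i).
    exact: le_lt_trans (le_trans th_le r0H) Hi.
  rewrite leNgt deadline_lt0 negb_and negb_or -!leNgt => /orP[Sb|/andP[vth uth]].
    have : H <= theta i by rewrite leNgt; apply/negP => /Sr; rewrite ltNge Sb.
    move=> Hth; have r0E : r0 = H.
      by apply/eqP; rewrite eq_le r0H (le_trans Hth).
    by move: drop; rewrite r0E SH XH subrr leNgt u0.
  have dr : runmax X (theta i) - X (theta i) <= u.
    by apply: drop_stopping_le => //; exact: ltW.
  have XE : X (theta i) = runmax X (theta i) - u.
    by apply/eqP; rewrite eq_le; apply/andP; split; move: dr uth; lra.
  have t0th : t0 <= theta i.
    rewrite leNgt; apply/negP => /ltW /(le_runmax cX) h.
    by have := lt_le_trans (uv i) (le_trans vth (le_trans h St0)); rewrite ltxx.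
  have Sb : runmax X (theta i) <= beta.
    by apply: runmax_stopping_le => //; rewrite X0 -XH ltW// Xpos.
  have xpos : 0 < X (theta i) by apply: Xpos; exact: lt_le_trans t0th.
  rewrite /potential /weight /vmax (max_r vth) fE; last first.
    have := uv i; move: Sb u0 vth; rewrite XE.
    by move=> h1 h2 h3 h4; apply/andP; split; lra.
  have sx := hsin_gt0 mu xpos.
  have e0 := wgt_scale_off u0 (runmax X (theta i)) (lt0r_neq0 sx).
  rewrite -XE subrr hsin0 mulr0 mul0r in e0.
  rewrite mulrBl addrAC e0 sub0r normrN normrM (ger0_norm (wgt_ge0 _ u0 (ltW (uv i)))).
  rewrite ler_wpM2l ?(wgt_ge0 _ u0 (ltW (uv i)))// BE//.
  by rewrite t0th (le_trans th_le).
- exact: cvg_cst.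
rewrite -[X in _ --> X](mul0r B); apply: cvgM; [exact: cvg_wgt_v|exact: cvg_cst].
Unshelve. all: by end_near. Qed.

End potential_limit.

(** * The event in terms of the running maximum *)

Section max_decrease_hitting.
Context {R : realType}.
Variables (u beta H : R) (w : path_space R).
Let X := cpath_fun w.
Hypotheses (H0 : 0 < H) (XH : X H = beta).
Hypothesis Sr : forall r, r < H -> runmax X r < beta.

Let cX : continuous X. Proof. exact: cpath_continuous. Qed.

Lemma hitting_timeE : hitting_time beta w = H%:E.
Proof.
apply/eqP; rewrite eq_le; apply/andP; split.
  by apply: ereal_inf_lbound; exists H => //; split => //; exact: ltW.
apply: le_ereal_inf_tmp => _ [r [r0 Xr] <-]; rewrite lee_fin leNgt; apply/negP => /Sr.
by rewrite ltNge -[in X in ~~ X]Xr runmax_ge// r0 lexx.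
Qed.

(** The strict inequality survives the supremum because the continuous drop [runmax X - X] stays
    below [u] by a margin on the compact [[0, H]]. *)
Lemma max_decrease_hittingP : (max_decrease (hitting_time beta w) w < u%:E)%E <->
  forall r, 0 <= r <= H -> runmax X r - X r < u.
Proof.
rewrite hitting_timeE; split=> [D r /andP[r0 rH]|nodrop].
  have [q [/andP[q0 qr] -> _]] := runmax_attained cX r0.
  rewrite -lte_fin; apply: le_lt_trans D; apply: ereal_sup_ubound.
  by exists q, r; split => //; rewrite lee_fin.
have cg : continuous (fun r => runmax X r - X r).
  by move=> x; apply: cvgB; [exact: continuous_runmax|exact: cX].
have [n Hn] := forall_lt_uniform (ltW H0) cg nodrop.
apply: (@le_lt_trans _ _ (u - n.+1%:R^-1)%:E); last by rewrite lte_fin gtrBl invr_gt0.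
apply: ge_ereal_sup => _ [s [t [s0 st tH ->]]].
have t0 := le_trans s0 st.
rewrite lee_fin in tH *; apply: le_trans (Hn t _); last by rewrite t0.
by rewrite lerD2r runmax_ge// s0.
Qed.

End max_decrease_hitting.

(** * The law of the Bessel process *)

Section bessel_law.
Context {R : realType}.
Variables (mu : R) (Q : probability (path_space R) R).
Hypothesis law : bessel3_law mu Q.

Lemma natural_filtration_measurable (t : R) (A : set (path_space R)) :
  natural_filtration t A -> measurable A.
Proof.
apply: sub_sigma_algebra2 => B [r [C [/andP[r0 rt] mC ->]]].
by exists r, C.
Qed.

Let bm := @bounded_mfun R _ (path_space R).

Section test_function.
Variables (f : R -> R) (F K : R).
Hypotheses (Cf : C2c_pos f) (ch : continuous (bessel3_generator mu f)).
Hypotheses (fF : forall x, `|f x| <= F) (K0 : 0 <= K)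
  (hK : forall x, `|bessel3_generator mu f x| <= K).

Let comp t (w : path_space R) := compensated f (bessel3_generator mu f) (cpath_fun w) t.

Lemma compensated_martingale : martingale Q (@natural_filtration R) comp.
Proof. by case: law => _ /(_ f Cf). Qed.

Lemma bounded_compensated (t : R) : 0 <= t -> bm (comp t).
Proof.
move=> t0; split.
  have [_ /(_ t t0) it _] := compensated_martingale.
  by apply/measurable_EFinP; exact: (measurable_int Q it).
exists (2 * F + K * t) => w.
by apply: compensated_bound => //; [exact: cpath_continuous|rewrite t0 lexx].
Qed.

Lemma expectation_increment (s t : R) (xi : path_space R -> R) (A : R) :
  0 <= s -> s <= t ->
  measurable_fun [set: paths [set r : R | 0 <= r <= s]]
    (xi : paths [set r : R | 0 <= r <= s] -> R) ->
  (forall w, 0 <= xi w <= A) ->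
  \int[Q]_w (xi w * (comp t w - comp s w)) = 0.
Proof.
move=> s0 st mxi xiA.
have Fxi a b : natural_filtration s [set w : path_space R | a <= xi w < b].
  have := mxi measurableT `[a, b[%classic (measurable_itv `[a, b[).
  rewrite setTI => H.
  have -> : [set w : path_space R | a <= xi w < b] = xi @^-1` `[a, b[%classic.
    by apply/seteqP; split => w /=; rewrite in_itv.
  exact: H.
apply: (@martingale_orthogonal _ _ _ Q (@natural_filtration R) comp s t) => //.
- exact: compensated_martingale.
- by move=> B; exact: natural_filtration_measurable.
- split.
    move=> _ B mB; apply: (@natural_filtration_measurable s).
    exact: mxi measurableT B mB.
  by exists A => w; have /andP[x0 xA] := xiA w; rewrite ger0_norm.
- by move=> w; have /andP[] := xiA w.
- exact: bounded_compensated.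
- by apply: bounded_compensated; exact: le_trans st.
Qed.

Lemma expectation_sum_increments (N : nat) (tau : nat -> R)
    (xi : nat -> path_space R -> R) (A : R) :
  (forall j, 0 <= tau j) -> (forall j, tau j <= tau j.+1) ->
  (forall j, measurable_fun [set: paths [set r : R | 0 <= r <= tau j]]
     (xi j : paths [set r : R | 0 <= r <= tau j] -> R)) ->
  (forall j w, 0 <= xi j w <= A) ->
  bm (fun w => \sum_(j < N) xi j w * (comp (tau j.+1) w - comp (tau j) w)) /\
  \int[Q]_w (\sum_(j < N) xi j w * (comp (tau j.+1) w - comp (tau j) w)) = 0.
Proof.
move=> tau0 tauS mxi xiA.
have bj j : bm (fun w => xi j w * (comp (tau j.+1) w - comp (tau j) w)).
  apply: bounded_mfunM; last by apply: bounded_mfunB; exact: bounded_compensated.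
  split.
    move=> _ B mB; apply: (@natural_filtration_measurable (tau j)).
    exact: mxi measurableT B mB.
  by exists A => w; have /andP[x0 xA] := xiA j w; rewrite ger0_norm.
split.
  exact: (@bounded_mfun_sum _ _ _ N
    (fun j w => xi j w * (comp (tau j.+1) w - comp (tau j) w))).
rewrite (@expectation_sum _ _ _ Q N (fun j w => xi j w * (comp (tau j.+1) w - comp (tau j) w)))//.
by rewrite big1// => j _; exact: (@expectation_increment _ _ _ A).
Qed.

End test_function.

(** Bounded convergence for the Riemann sums, whose expectations are zero. The window of [f] starts
    at [(v - u) / 2 > 0], and one [f] serves all horizons [T]. *)
Lemma expectation_potential (u v beta : R) : 0 < u -> u < v -> v < beta ->
  exists f : R -> R,
   (forall x, (v - u) / 2 <= x <= beta + 1 -> f x = hscale mu x) /\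
   forall T : nat, let Z w := potential mu u v f (cpath_fun w)
       (stopping u v beta (cpath_fun w) T%:R) -
       potential mu u v f (cpath_fun w) 0 in
     measurable_fun [set: path_space R] (Z : path_space R -> R) /\
     \int[Q]_w Z w = 0.
Proof.
move=> u0 uv vb.
have a0 : 0 < (v - u) / 2 by rewrite divr_gt0// subr_gt0.
have ab : (v - u) / 2 <= beta + 1 by move: u0 uv vb; lra.
have [|||f [Cf cgen [K K0 hK] fE fsupp]] :=
  @bessel3_extension _ mu (hscale mu) (fun x => hsin mu x ^- 2)
   (fun x => - 2 * hcos mu x / hsin mu x ^+ 3) _ _ a0 ab.
- by move=> x; exact: is_derive_hscale.
- by move=> x; exact: is_derive_hscale'.
- move=> x x0; have s0 := lt0r_neq0 (hsin_gt0 mu x0).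
  have c1 := continuous_is_derive (is_derive_hcos mu x).
  have c2 := continuous_is_derive (is_derive_hsin mu x).
  apply: cvgM; first by apply: cvgM; [exact: cvg_cst|exact: c1].
  apply: cvgV; first by rewrite expf_neq0.
  apply: (@continuous_comp _ _ _ (hsin mu) (fun y : R => y ^+ 3)) => //.
  exact: exprn_continuous.
have cf : continuous f.
  case: Cf => df _ _ _ x; apply: differentiable_continuous.
  exact/derivable1_diffP.
have [F F0 fF] : exists2 F, 0 <= F & forall x, `|f x| <= F.
  apply: (@bounded_compact_support _ _ ((v - u) / 2 / 2) (beta + 1 + 1)) => // x.
  by case: (fsupp x) => // -[-> _].
have fE' x : (v - u) / 2 <= x <= beta + 1 -> f x = hscale mu x by case: (fE x).
exists f; split => //.
move=> T Z.
pose h := bessel3_generator mu f.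
have hE x : (v - u) / 2 < x < beta + 1 -> h x = 0.
  move=> xab; rewrite /h; have [_ ->//] := fE x.
  have x0 : 0 < x by case/andP: xab => /(lt_trans a0).
  by field; rewrite gt_eqF// hsin_gt0.
pose rs n (w : path_space R) := riemann_sum mu u v beta f h (cpath_fun w) T n.
have H n : bm (rs n) /\ \int[Q]_w rs n w = 0.
  apply: (@expectation_sum_increments f F K _ _ _ _ _ _ (grid n)
    (fun j w => alive_weight mu u v beta (cpath_fun w) (grid n j))
    (wgt mu u beta - wgt mu u v)) => //.
  - by move=> j; exact: grid_ge0.
  - by move=> j; exact: le_grid.
  - by move=> j; apply: measurable_alive_weight => //; exact: grid_ge0.
  move=> j w; rewrite /alive_weight; case: ifPn => [/asboolP al|_].
    rewrite weight_ge0//=; apply: alive_weight_le => //.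
    exact: grid_ge0.
  rewrite lexx subr_ge0 ler_wgt// ltW//; exact: lt_trans uv.
have cvgZ w : rs n w @[n --> \oo] --> Z w.
  exact: (cvg_riemann_sum u0 uv vb cf cgen (@cpath_continuous _ w) fE' hE).
have mZ : measurable_fun [set: path_space R] (Z : path_space R -> R).
  apply: (@measurable_fun_cvg _ _ _ _ rs) => [n|w _]; last exact: cvgZ.
  by have [[]] := H n.
split => //.
have cv : \int[Q]_w rs n w @[n --> \oo] --> \int[Q]_w Z w.
  apply: (@bounded_convergence _ _ _ Q rs Z
    (2 * (2 * F + K * T%:R) * (wgt mu u beta - wgt mu u v))) => //.
  - by move=> n; have [[]] := H n.
  - exact: aeW.
  - apply: aeW => w n.
    exact: (riemann_sum_bound mu u0 uv vb cgen (@cpath_continuous _ w) T n K0 fF hK).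
have : (0 : R) @[n --> \oo] --> \int[Q]_w Z w.
  by apply: cvg_trans cv; apply: near_eq_cvg; near=> n; have [_ ->] := H n.
by move=> c; rewrite -(cvg_lim (@Rhausdorff R) c) lim_cst.
Unshelve. all: by end_near. Qed.

End bessel_law.

(** * Almost sure finiteness of the hitting time of [beta] *)

Section hitting.
Context {R : realType}.
Variables (mu : R) (Q : probability (path_space R) R).
Hypothesis law : bessel3_law mu Q.

(** Time starts at [1] because the process starts at [0], below every [eps > 0]. The two-sided bound
    is written as a single inequality to fit [measurable_forall_le]. *)
Definition stay (eps beta : R) (t : R) : set (cpath R) :=
  [set w | forall r, 1 <= r <= t -> Num.max (eps - cpath_fun w r) (cpath_fun w r - beta) <= 0].

Lemma stayP eps beta t w : stay eps beta t w <->
  forall r, 1 <= r <= t -> eps <= cpath_fun w r <= beta.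
Proof.
by split=> H r /H; rewrite ge_max !subr_le0.
Qed.

Lemma measurable_stay (I : set R) eps beta t : 1 <= t -> (forall r, 0 <= r <= t -> I r) ->
  @measurable _ (paths I) (stay eps beta t).
Proof.
move=> t1 It; apply: measurable_forall_le => //.
  move=> w x; have cX := @cpath_continuous _ w.
  apply: (@continuous_max _ _ (fun r => eps - cpath_fun w r) (fun r => cpath_fun w r - beta)).
    by apply: cvgB; [exact: cvg_cst|exact: cX].
  by apply: cvgB; [exact: cX|exact: cvg_cst].
move=> r /andP[r1 rt].
have mX : measurable_fun [set: paths I] (fun w : paths I => cpath_fun w r).
  by apply: measurable_cpath_fun; apply: It; rewrite rt (le_trans _ r1).
by apply: measurable_maxr; apply: measurable_funB.
Qed.

(** While the path stays in [[eps, beta]] the compensator of the truncated square grows at rate at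
    least [1], and the truncated square is at most [(beta + 2) ^+ 2]. Taking expectations bounds the
    mean time spent, uniformly in [eps]. *)
Lemma stay_bound (eps beta : R) (m : nat) : 0 < eps -> eps <= beta ->
  fine (Q (stay eps beta (1 + m%:R))) * m%:R <= (beta + 2) ^+ 2 + 1.
Proof.
move=> e0 eb.
have a0 : 0 < eps / 2 by rewrite divr_gt0.
have ab : eps / 2 <= beta + 1 by move: e0 eb; lra.
have [|||f [Cf cgen [K K0 hK] fE fsupp]] :=
  @bessel3_extension _ mu (fun x : R => x ^+ 2) (fun x => 2 * x) (fun=> 2) _ _ a0 ab.
- by move=> x _; apply: is_derive_eq; rewrite /GRing.scale/=; ring.
- by move=> x _; apply: is_derive_eq; rewrite /GRing.scale/=; ring.
- by move=> x _; exact: cvg_cst.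
pose h := bessel3_generator mu f.
have f_bd x : 0 <= f x <= (beta + 2) ^+ 2.
  have F0 : 0 <= (beta + 2) ^+ 2 by exact: sqr_ge0.
  have [->|[/andP[x1 x2] [c /andP[c0 c1] ->]]] := fsupp x; first by rewrite lexx.
  have x0 : 0 < x by apply: lt_trans x1; rewrite !divr_gt0.
  rewrite mulr_ge0 ?sqr_ge0//=; apply: (@le_trans _ _ (1 * x ^+ 2)).
    by rewrite ler_wpM2r// sqr_ge0.
  rewrite mul1r lerXn2r// ?nnegrE ?(ltW x0)//.
    by move: e0 eb; lra.
  by move: x2; lra.
have fF x : `|f x| <= (beta + 2) ^+ 2 by have /andP[? ?] := f_bd x; rewrite ger0_norm.
have hge x : eps <= x <= beta -> 1 <= h x.
  move=> /andP[x1 x2]; rewrite /h; have [_ ->] := fE x; last first.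
    by apply/andP; split; move: e0 x1 x2; lra.
  have x0 : 0 < x by exact: lt_le_trans x1.
  rewrite mulVf// lerDl; apply: mulr_ge0; last by rewrite mulr_ge0 ?(ltW x0).
  by apply: divr_ge0; apply: ltW; [exact: hcos_gt0|exact: hsin_gt0].
(* On the last grid step the path may leave the window, where only [h >= - K] is known. Replacing
   the rate [1] by [- K] loses at most [(K + 1) / (n + 1)], which the additive [1] of the bound
   absorbs. *)
have [n nK] : exists n : nat, n.+1%:R^-1 < (K + 1)^-1.
  by apply: natSinv_lt; rewrite invr_gt0 ltr_wpDl.
have K1 : 0 < K + 1 by rewrite ltr_wpDl.
have {}nK : (K + 1) * n.+1%:R^-1 <= 1.
  by rewrite mulrC -ler_pdivlMr// mul1r ltW.
pose tau (j : nat) : R := 1 + grid n j.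
pose comp t (w : path_space R) := compensated f h (cpath_fun w) t.
pose N := (m * n.+1)%N.
pose xi (j : nat) (w : cpath R) : R := if `[< stay eps beta (tau j) w >] then 1 else 0.
have tau1 j : 1 <= tau j by rewrite lerDl grid_ge0.
have le_tau i j : (i <= j)%N -> tau i <= tau j by move=> ij; rewrite lerD2l le_grid.
have tau0 j : 0 <= tau j by exact: le_trans (tau1 j).
have tauN : tau N = 1 + m%:R by rewrite /tau grid_max.
have [bS ES] : bounded_mfun (fun w : path_space R =>
      \sum_(j < N) xi j w * (comp (tau j.+1) w - comp (tau j) w)) /\
    \int[Q]_w (\sum_(j < N) xi j w * (comp (tau j.+1) w - comp (tau j) w)) = 0.
  apply: (@expectation_sum_increments _ mu Q law f ((beta + 2) ^+ 2) K _ _ _ _ _ _ tau xi 1) => //.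
  - by move=> j; exact: le_tau.
  - move=> j; apply: (measurable_fun_ifT
      (f := fun w : paths _ => `[< stay eps beta (tau j) w >])) => //.
    apply: (measurable_fun_bool true); rewrite setTI.
    rewrite (_ : _ @^-1` _ = stay eps beta (tau j)); first exact: measurable_stay.
    by apply/seteqP; split=> w /= /asboolP.
  - by move=> j w; rewrite /xi; case: ifP; rewrite ?lexx ler01.
pose E := stay eps beta (1 + m%:R) : set (path_space R).
have mE : @measurable _ (path_space R) E.
  by apply: measurable_stay; [rewrite lerDl|move=> r /andP[]].
have path_bd (w : path_space R) : \sum_(j < N) xi j w * (comp (tau j.+1) w - comp (tau j) w) <=
    (beta + 2) ^+ 2 + 1 - m%:R * \1_E w.
  have cX := @cpath_continuous _ w.
  have [|J [JN PJ nPJ HJ]] := @sum_downward_closed R (fun j => `[< stay eps beta (tau j) w >]) N.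
    move=> i j ij /asboolP Sj; apply/asboolP => r /andP[r1 rt]; apply: Sj.
    by rewrite r1 (le_trans rt)// le_tau.
  have -> : \sum_(j < N) xi j w * (comp (tau j.+1) w - comp (tau j) w) =
      comp (tau J) w - comp (tau 0) w.
    transitivity (\sum_(j < N) (if `[< stay eps beta (tau j) w >] then
       comp (tau j.+1) w - comp (tau j) w else 0)).
      by apply: eq_bigr => j _; rewrite /xi; case: ifP; rewrite ?mul1r ?mul0r.
    rewrite (HJ (fun j => comp (tau j.+1) w - comp (tau j) w)).
    rewrite -(big_mkord xpredT (fun j => comp (tau j.+1) w - comp (tau j) w)).
    by rewrite telescope_sumr.
  have main : comp (tau J) w - comp (tau 0) w <= (beta + 2) ^+ 2 + 1 - grid n J.
    case: J JN PJ {nPJ HJ} => [|J] JN PJ.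
      by rewrite subrr /grid mul0r subr0 addr_ge0// sqr_ge0.
    have cg : continuous (fun r => h (cpath_fun w r)).
      by move=> x; apply: continuous_comp; [exact: cX|exact: cgen].
    have /asboolP/stayP SJ := PJ J (ltnSn J).
    have b1 : forall r, tau J <= r <= tau J.+1 -> - K <= h (cpath_fun w r) <= K.
      by move=> r _; rewrite -ler_norml.
    have b2 : forall r, tau 0%N <= r <= tau J -> 1 <= h (cpath_fun w r) <= K.
      move=> r; rewrite /tau {1}/grid mul0r addr0 => rJ.
      by rewrite hge ?SJ//=; apply: le_trans (ler_norm _) (hK _).
    have /andP[i1 _] := Rintegral_bounds cg (tau0 J) (le_tau _ _ (leqnSn J)) b1.
    have /andP[i2 _] := Rintegral_bounds cg (tau0 0%N) (le_tau _ _ (leq0n J)) b2.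
    have /andP[_ f1] := f_bd (cpath_fun w (tau J.+1)).
    have /andP[f2 _] := f_bd (cpath_fun w (tau 0%N)).
    have g0 : grid n 0 = 0 :> R by rewrite /grid mul0r.
    move: i1 i2; rewrite /comp /compensated /tau gridS g0.
    rewrite /tau gridS g0 in f1 f2.
    move: nK f1 f2; move: (n.+1%:R^-1) (grid n J) => c g.
    set I1 := Rintegral _ _ _; set I2 := Rintegral _ _ _; set I3 := Rintegral _ _ _.
    move: (f _) (f _) (f _) => y1 y2 y3.
    move=> *; lra.
  apply: le_trans main _; rewrite lerD2l lerN2 indicE.
  case: (boolP (w \in E)) => [|_]; last by rewrite mulr0 grid_ge0.
  rewrite inE => Ew; rewrite mulr1 -(grid_max m n).
  suff -> : J = N by [].
  apply/eqP; rewrite eqn_leq JN leqNgt; apply/negP => JltN.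
  move: (nPJ JltN) => /asboolP; apply => r /andP[r1 rt]; apply: Ew.
  by rewrite r1 (le_trans rt)// -tauN le_tau.
have := @le_expectation _ _ _ Q _ _ bS _ path_bd.
have b1 := @bounded_mfun_indic R _ (path_space R) E mE.
have b1E := bounded_mfunM (bounded_mfun_cst (path_space R) m%:R) b1.
have bc := bounded_mfun_cst (path_space R) ((beta + 2) ^+ 2 + 1).
rewrite ES => /(_ (bounded_mfunB bc b1E)).
rewrite (expectationB Q bc b1E) expectation_cst expectationZ//.
by rewrite expectation_indic// subr_ge0 mulrC.
Qed.

(** A path that never hits [beta] stays below it, and its minimum on each [[1, 1 + m.+1]] is
    positive, so it lies in every [U m]. Since the bound on [V m k] is free of [k], the probability
    of [U m] is at most [C / m.+1]. *)
Lemma hits_ae (beta : R) : 0 < beta ->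
  \forall w \ae Q, exists2 t, 0 <= t & coordinate t w = beta.
Proof.
move=> b0.
pose V (m k : nat) : set (path_space R) := stay (beta / k.+1%:R) beta (1 + m.+1%:R).
have mV m k : @measurable _ (path_space R) (V m k).
  by apply: measurable_stay; [rewrite lerDl|move=> r /andP[]].
pose U m := \bigcup_k V m k.
have mU m : @measurable _ (path_space R) (U m) by apply: bigcupT_measurable.
pose B := \bigcap_m U m.
have mB : @measurable _ (path_space R) B by apply: bigcapT_measurable.
pose C := (beta + 2) ^+ 2 + 1.
have VC m k : (Q (V m k) <= (C / m.+1%:R)%:E)%E.
  have e0 : 0 < beta / k.+1%:R by rewrite divr_gt0.
  have eb : beta / k.+1%:R <= beta by rewrite ler_pdivrMr// ler_peMr ?(ltW b0)// ler1n.
  have := stay_bound m.+1 e0 eb; rewrite -ler_pdivlMr// => H.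
  by rewrite -[X in (X <= _)%E]fineK ?fin_num_measure// lee_fin.
have ndV m : nondecreasing_seq (V m).
  move=> k l kl; apply/subsetPset => w /stayP Sw; apply/stayP => r r1.
  have /andP[h1 h2] := Sw r r1; rewrite h2 andbT; apply: le_trans h1.
  by rewrite ler_pM2l// lef_pV2 ?posrE// ler_nat.
have UC m : (Q (U m) <= (C / m.+1%:R)%:E)%E.
  have cv := @nondecreasing_cvg_mu _ _ _ Q (V m) (mV m) (mU m) (ndV m).
  have <- := cvg_lim (@ereal_hausdorff R) cv; apply: lime_le.
    by apply/cvg_ex; eexists; exact: cv.
  by apply: nearW => k /=; exact: VC.
have BU m : (Q B <= (C / m.+1%:R)%:E)%E.
  apply: le_trans (UC m); apply: le_measure; rewrite ?inE//.
  by move=> w; apply.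
have QB0 : Q B = 0%E.
  apply/eqP; rewrite eq_le measure_ge0 andbT.
  have QBfin := fin_num_measure Q B mB.
  rewrite -[X in (X <= _)%E]fineK// lee_fin leNgt; apply/negP => QBpos.
  have C0 : 0 < C by rewrite ltr_wpDl// sqr_ge0.
  have /natSinv_lt[m mC] : 0 < fine (Q B) / C by rewrite divr_gt0.
  have := BU m; rewrite -[X in (X <= _)%E]fineK// lee_fin leNgt => /negP; apply.
  by rewrite mulrC -ltr_pdivlMr.
have nB : \forall w \ae Q, ~ B w.
  by exists B; split => // w /= /contrapT.
have [good _] := law; apply: filterS2 good nB => w [X0 Xpos] nBw.
apply: contrapT => nohit; apply: nBw => m _.
have cX := @cpath_continuous _ w.
have Xlt t : 0 <= t -> cpath_fun w t < beta.
  move=> t0; rewrite ltNge; apply/negP => bt; apply: nohit.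
  have [||c ctt Xc] := @IVT _ (cpath_fun w) 0 t beta t0.
  - exact: continuous_subspaceT.
  - by rewrite -/(coordinate 0 w) X0 ge_min le_max (ltW b0) bt orbT.
  by exists c => //; move: ctt; rewrite in_itv => /andP[].
have m1 : 1 <= 1 + m.+1%:R :> R by rewrite lerDl.
have [|c cab Hc] := @EVT_min _ (cpath_fun w) 1 (1 + m.+1%:R) m1.
  exact: continuous_subspaceT.
have c0 : 0 < cpath_fun w c.
  by apply: Xpos; move: cab; rewrite in_itv/= => /andP[c1 _]; exact: lt_le_trans c1.
have /natSinv_lt[k kc] : 0 < cpath_fun w c / beta by rewrite divr_gt0.
exists k => //; apply/stayP => r r1.
have r0 : 0 <= r by case/andP: r1 => r1 _; exact: le_trans r1.
rewrite (ltW (Xlt _ r0)) andbT; apply: (@le_trans _ _ (cpath_fun w c)).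
  by rewrite mulrC ltW// -ltr_pdivlMr.
by apply: Hc; rewrite in_itv.
Qed.

End hitting.

(** * Passage to the limit and the probability of the event *)

Section drop_probability.
Context {R : realType}.
Variables (mu : R) (Q : probability (path_space R) R).
Hypothesis law : bessel3_law mu Q.

Lemma max_decrease_probability (u beta : R) : 0 < u -> u < beta ->
  Q [set w | (max_decrease (hitting_time beta w) w < u%:E)%E] =
  (hsin mu beta / hsin mu u * expR (- (kappa mu u * (beta - u))))%:E.
Proof.
move=> u0 ub; have b0 := lt_trans u0 ub.
set E := [set w : path_space R | (max_decrease (hitting_time beta w) w < u%:E)%E].
have mE : @measurable _ (path_space R) E by exact: measurable_max_decrease_lt.
(* The denominator starts at [2] so that [v_ i < beta] already for [i = 0]. *)
pose v_ (i : nat) := u + (beta - u) / i.+2%:R.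
have uv i : u < v_ i by rewrite ltrDl divr_gt0// subr_gt0.
have vb i : v_ i < beta.
  rewrite -ltrBrDl ltr_pdivrMr// ltr_pMr ?subr_gt0//.
  by rewrite ltr1n.
have cvg_v : v_ i @[i --> \oo] --> u.
  rewrite -[X in _ --> X]addr0; apply: cvgD; first exact: cvg_cst.
  rewrite -(mulr0 (beta - u)); apply: cvgM; first exact: cvg_cst.
  by have := @cvg_harmonic R; rewrite -(cvg_shiftS (@harmonic R)).
have [f_ Hf] := choice (fun i => expectation_potential law u0 (uv i) (vb i)).
pose W i (w : path_space R) := potential mu u (v_ i) (f_ i) (cpath_fun w)
   (stopping u (v_ i) beta (cpath_fun w) i%:R) -
   potential mu u (v_ i) (f_ i) (cpath_fun w) 0.
have fE i x : (v_ i - u) / 2 <= x <= beta + 1 -> f_ i x = hscale mu x.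
  by have [+ _] := Hf i; exact.
have mW i : measurable_fun [set: path_space R] (W i).
  by have [_ /(_ i)[]] := Hf i.
have EW i : \int[Q]_w W i w = 0.
  by have [_ /(_ i)[]] := Hf i.
pose g := expR (kappa mu u * beta) / hsin mu beta.
have su := hsin_gt0 mu u0; have sb := hsin_gt0 mu b0.
have cv_off : off mu u (v_ i) @[i --> \oo] --> off mu u u.
  have co : {for u, continuous (off mu u)} by exact: continuous_off.
  exact: (cvg_comp v_ (off mu u) cvg_v co).
have [good _] := law.
(* [g] is [F(beta, beta)]. As each [W i] has zero expectation, the limit gives
   [g * Q E = off mu u u]. *)
have cvW : \forall w \ae Q, W i w @[i --> \oo] --> g * \1_E w - off mu u u.
  apply: filterS2 good (hits_ae law b0) => w [X0 Xpos] [t1 t10 Xt1].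
  have cX := @cpath_continuous _ w.
  rewrite /coordinate in X0 Xpos Xt1.
  have X0b : cpath_fun w 0 < beta by rewrite X0.
  have [H [H0 XH SH Sr]] := first_hitting_exists cX X0b t10 Xt1.
  have p0 i : potential mu u (v_ i) (f_ i) (cpath_fun w) 0 = off mu u (v_ i).
    by apply: potential0 => //; rewrite X0 ltW// (lt_trans u0 (uv i)).
  rewrite /W; under eq_cvg do rewrite p0.
  apply: cvgB => //.
  have [Ew|nEw] := pselect (E w).
    have nd := (max_decrease_hittingP u H0 XH Sr).1 Ew.
    rewrite indicE mem_set// mulr1.
    exact: (cvg_potential_no_drop u0 uv vb fE cvg_v Xpos H0 XH SH Sr nd).
  rewrite indicE memNset// mulr0.
  have [r rH ru] : exists2 r, 0 <= r <= H & u <= runmax (cpath_fun w) r - cpath_fun w r.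
    apply: contrapT => nr; apply: nEw; apply/(max_decrease_hittingP u H0 XH Sr) => r rH.
    by rewrite ltNge; apply/negP => ur; apply: nr; exists r.
  exact: (cvg_potential_drop cX u0 uv fE cvg_v X0 Xpos H0 XH SH Sr rH ru).
have bW : \forall w \ae Q, forall i, `|W i w| <= 4 * off mu u beta.
  apply: filterS good => w [X0 _] i.
  have cX := @cpath_continuous _ w.
  have X0v : cpath_fun w 0 <= v_ i.
    by rewrite /coordinate in X0; rewrite X0 ltW// (lt_trans u0 (uv i)).
  have i0 : 0 <= i%:R :> R by [].
  have b1 := potential_stopping_bound cX u0 (uv i) (vb i) (fE i) X0v i0.
  have b2 := ler_off mu u0 (ltW (vb i)); have b3 := off_ge0 mu u0 (v_ i).
  apply: le_trans (ler_normB _ _) _; rewrite potential0// (ger0_norm b3).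
  move: b1 b2 b3; move: (off _ _ _) (off _ _ _) `|_| => x y z; lra.
have b1 := @bounded_mfun_indic R _ (path_space R) E mE.
have bg := bounded_mfunM (bounded_mfun_cst (path_space R) g) b1.
have bo := bounded_mfun_cst (path_space R) (off mu u u).
have [mlim _] := bounded_mfunB bg bo.
have := bounded_convergence mW mlim cvW bW.
under eq_cvg do rewrite EW.
move=> c.
have : \int[Q]_w (g * \1_E w - off mu u u) = 0.
  by rewrite -(cvg_lim (@Rhausdorff R) c) lim_cst.
rewrite (expectationB Q bg bo) (expectationZ Q _ b1) expectation_indic// expectation_cst.
move=> /eqP; rewrite subr_eq0 => /eqP e.
rewrite -[LHS]fineK ?fin_num_measure//; congr (_%:E).
have g0 : 0 < g by rewrite divr_gt0 ?expR_gt0.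
have -> : fine (Q E) = off mu u u / g by rewrite -e mulrC mulKf// gt_eqF.
rewrite /off /g subrr /hcos mulr0 oppr0 expR0 mulrBr opprB expRD expRN.
by field; rewrite !gt_eqF ?expR_gt0.
Qed.

End drop_probability.

Lemma scaleE (R : realType) (mu x : R) : 0 < mu ->
  scale (- mu) x = expR (mu * x) * hsin mu x.
Proof.
move=> mu0; rewrite /scale oppr_eq0 gt_eqF//.
rewrite (_ : - (2 * - mu * x) = mu * x + mu * x); last by ring.
by rewrite /hsin gt_eqF// expRN expRD; field; rewrite !gt_eqF ?expR_gt0.
Qed.

Theorem proposition2p5 (R : realType) :
  (forall (mu : R) (Q : probability (path_space R) R),
     0 < mu -> bessel3_law mu Q ->
     forall beta u : R, 0 < u -> u < beta ->
       Q [set w | (max_decrease (hitting_time beta w) w < u%:E)%E] =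
       (scale (- mu) beta / scale (- mu) u *
        expR (- ((beta - u) / scale (- mu) u) - 2 * mu * (beta - u)))%:E)
  /\
  (forall Q : probability (path_space R) R,
     bessel3_law 0 Q ->
     forall beta u : R, 0 < u -> u < beta ->
       Q [set w | (max_decrease (hitting_time beta w) w < u%:E)%E] =
       (beta / u * expR (- ((beta - u) / u)))%:E).
Proof.
split=> [mu Q mu0 law beta u u0 ub|Q law beta u u0 ub];
    rewrite (max_decrease_probability law u0 ub); congr (_%:E).
  rewrite !scaleE//; have su := hsin_gt0 mu u0.
  (* That is, [kappa = mu + 1 / scale (- mu) u]. The ratio of scale functions exceeds that of [hsin]
     by the factor [expR (mu * (beta - u))], which is why the stated exponent contains [2 * mu] and
     not [mu]. *)
  have kE : kappa mu u = mu + (expR (mu * u) * hsin mu u)^-1.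
    have hc : hcos mu u = mu * hsin mu u + (expR (mu * u))^-1.
      by rewrite /hcos /hsin gt_eqF// expRN; field; rewrite !gt_eqF ?expR_gt0.
    by rewrite /kappa hc; field; rewrite !gt_eqF ?expR_gt0.
  rewrite (_ : _ - 2 * mu * _ = - (kappa mu u * (beta - u)) + (mu * u - mu * beta)); last first.
    by rewrite kE; ring.
  rewrite (expRD (- _)) (expRD (mu * u)) (expRN (mu * beta)).
  by field; rewrite !gt_eqF ?expR_gt0.
have -> : kappa 0 u = u^-1.
  by rewrite /kappa /hcos /hsin eqxx mul0r oppr0 expR0; field; rewrite gt_eqF.
by rewrite /hsin eqxx [u^-1 * _]mulrC.
Qed.
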